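(* Let $X$ be an arbitrary complex Banach space and let $A$ be the generator of an analytic semigroup on $X$. Let $1\le k\le 6$ and suppose that $A(\lambda-A)^{-1}$ is uniformly bounded for $\lambda\in\Sigma_\vartheta$ with an angle $\vartheta>\pi-\alpha$, where $\alpha$ is the angle of A($\alpha$)-stability of the $k$-step BDF method. Then the numerical solution $(u_n)_{n=k}^N$ of $$\frac1\tau\sum_{j=0}^k\delta_ju_{n-j}=Au_n+f_n,\qquad n\ge k,\qquad u_0=\dots=u_{k-1}=0,$$ obtained by the $k$-step BDF method with stepsize $\tau$, is bounded by $$\|(Au_n)_{n=1}^N\|_{\ell^p(X)}\le C\,\log N\,\|(f_n)_{n=1}^N\|_{\ell^p(X)},$$ where the constant $C$ is independent of $N$ and $\tau$ and $1\le p\le\infty$.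
   Context: $\Sigma_\vartheta=\{z\in\mathbb C\setminus\{0\}:|\arg z|<\vartheta\}$. The coefficients $\delta_0,\dots,\delta_k$ of the $k$-step BDF method are given by $\delta(\zeta)=\sum_{j=0}^k\delta_j\zeta^j=\sum_{\ell=1}^k\frac1\ell(1-\zeta)^\ell$. A($\alpha$)-stability of the method is equivalent to $|\arg\delta(\zeta)|\le\pi-\alpha$ for all complex $\zeta$ with $|\zeta|\le1$, $\zeta\ne1$; the angle of A($\alpha$)-stability is $\alpha=90^\circ,90^\circ,86.03^\circ,73.35^\circ,51.84^\circ,17.84^\circ$ for $k=1,\dots,6$, respectively. The stepsize is $\tau>0$ and the $f_n$ are elements of $X$. For a finite sequence $(v_n)$ in $X$, $\|(v_n)\|_{\ell^p(X)}=\big(\sum_n\|v_n\|_X^p\big)^{1/p}$ for $p<\infty$ and $\max_n\|v_n\|_X$ for $p=\infty$.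
   Formalization: The bound is stated for N ≥ 2, since for k = N = 1 the printed right-hand side is zero (log 1 = 0) while Au_1 is in general nonzero (e.g. X = ℂ, A = −1, τ = 1, f_1 = 1). *)

(* Defs.v *)
From Stdlib Require Import Reals List Lra Lia.
From Coquelicot Require Import Coquelicot.

Open Scope R_scope.

(** * Sectors *)

(* Principal argument, with values in (-PI, PI]; its value at 0 is irrelevant. *)
Definition Carg (z : C) : R :=
  if Rle_dec 0 (Im z) then acos (Re z / Cmod z) else - acos (Re z / Cmod z).

Definition sector (theta : R) (z : C) : Prop :=
  z <> RtoC 0 /\ Rabs (Carg z) < theta.

(** * Unbounded operators, resolvents and analytic semigroups *)

(* A linear operator A : D(A) -> X on a subspace D(A) of X.  The underlying
   function is total, but its values outside the domain carry no meaning. *)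
Record linear_operator (X : NormedModule C_AbsRing) := LinearOperator {
  op : X -> X;
  dom : X -> Prop;
  dom_zero : dom zero;
  dom_plus : forall x y, dom x -> dom y -> dom (plus x y);
  dom_scal : forall (c : C) x, dom x -> dom (scal c x);
  op_plus : forall x y, dom x -> dom y -> op (plus x y) = plus (op x) (op y);
  op_scal : forall (c : C) x, dom x -> op (scal c x) = scal c (op x) }.

Arguments op {X} l x.
Arguments dom {X} l x.
Coercion op : linear_operator >-> Funclass.

(* [Res] is the bounded inverse of lambda - A : D(A) -> X. *)
Definition is_resolvent {X : NormedModule C_AbsRing} (A : linear_operator X)
    (lambda : C) (Res : X -> X) : Prop :=
  is_linear Res /\
  (forall x, dom A (Res x) /\ minus (scal lambda (Res x)) (A (Res x)) = x) /\
  (forall x, dom A x -> Res (minus (scal lambda x) (A x)) = x).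

(* A (lambda - A)^{-1} exists and is uniformly bounded on the sector. *)
Definition A_resolvent_bounded {X : NormedModule C_AbsRing}
    (A : linear_operator X) (theta : R) : Prop :=
  exists M : R, forall lambda : C, sector theta lambda ->
    exists Res : X -> X, is_resolvent A lambda Res /\
      forall x : X, norm (A (Res x)) <= M * norm x.

(* T restricted to the sector of half-angle phi, together with 0, is an analytic
   semigroup of bounded operators. Analyticity is that of all orbits, which is
   equivalent to analyticity in operator norm. No boundedness of the semigroup on
   the whole sector is required. *)
Definition analytic_semigroup {X : NormedModule C_AbsRing}
    (phi : R) (T : C -> X -> X) : Prop :=
  (forall z, sector phi z -> is_linear (T z)) /\
  (forall x, T (RtoC 0) x = x) /\
  (forall z w x, sector phi z -> sector phi w ->
     T (Cplus z w) x = T z (T w x)) /\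
  (forall z x, sector phi z ->
     ex_derive (K := C_AbsRing) (V := X) (fun w => T w x) z) /\
  (forall x, filterlim (fun z => T z x)
     (within (sector phi) (locally (T := C_UniformSpace) (RtoC 0)))
     (locally x)).

Definition generates_analytic_semigroup {X : NormedModule C_AbsRing}
    (A : linear_operator X) : Prop :=
  exists (phi : R) (T : C -> X -> X),
    0 < phi <= PI / 2 /\ analytic_semigroup phi T /\
    forall x y : X,
      (dom A x /\ A x = y) <->
      filterlim (fun t : R => scal (RtoC (/ t)) (minus (T (RtoC t) x) x))
        (at_right 0) (locally y).

(** * BDF methods *)

(* delta(zeta) = sum_(1 <= l <= k) (1 - zeta)^l / l *)
Definition bdf_symbol (k : nat) (zeta : C) : C :=
  sum_n_m (fun l => (RtoC (/ INR l) * (RtoC 1 - zeta) ^ l)%C) 1 k.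

(* [Binomial.C l j] is only meaningful for j <= l. *)
Definition binom (l j : nat) : R :=
  if (j <=? l)%nat then Binomial.C l j else 0.

(* The coefficients delta_j of delta(zeta); see [bdf_delta_symbol]. *)
Definition bdf_delta (k j : nat) : R :=
  sum_n_m (fun l => / INR l * ((-1) ^ j * binom l j)) 1 k.

Definition A_alpha_stable (k : nat) (alpha : R) : Prop :=
  forall zeta : C, Cmod zeta <= 1 -> zeta <> RtoC 1 ->
    bdf_symbol k zeta <> RtoC 0 /\
    Rabs (Carg (bdf_symbol k zeta)) <= PI - alpha.

(* The largest alpha (in radians) for which the method is A(alpha)-stable. *)
Definition bdf_angle (k : nat) : R := real (Lub_Rbar (A_alpha_stable k)).

Definition bdf_solution {X : NormedModule C_AbsRing} (A : linear_operator X)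
    (k N : nat) (tau : R) (f u : nat -> X) : Prop :=
  (forall n, (n < k)%nat -> u n = zero) /\
  (forall n, (k <= n <= N)%nat ->
     dom A (u n) /\
     scal (RtoC (/ tau))
       (sum_n (fun j => scal (RtoC (bdf_delta k j)) (u (n - j)%nat)) k)
     = plus (A (u n)) (f n)).

(** * Norm of the finite sequence v_1, ..., v_N in l^p(X) *)

(* [Rpower 0 y] is 1 in the library, whereas 0^y = 0 is needed here. *)
Definition pow_nneg (x y : R) : R := if Rle_dec x 0 then 0 else Rpower x y.

Definition lp_norm {X : NormedModule C_AbsRing} (p : Rbar) (N : nat)
    (v : nat -> X) : R :=
  match p with
  | Finite q => pow_nneg (sum_n_m (fun n => pow_nneg (norm (v n)) q) 1 N) (/ q)
  | p_infty => fold_right Rmax 0 (map (fun n => norm (v n)) (seq 1 N))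
  | m_infty => 0
  end.

(** * The coefficients of the BDF generating polynomial *)

Local Ltac C_ring := match goal with |- ?a = ?b => change (@eq C a b) end; ring.

Lemma binom_0 (l : nat) : binom l 0 = 1.
Proof. apply C_n_0. Qed.

Lemma binom_gt (l j : nat) : (l < j)%nat -> binom l j = 0.
Proof.
  intros H; unfold binom.
  destruct (Nat.leb_spec j l); [lia | reflexivity].
Qed.

Lemma binom_SS (l j : nat) : binom (S l) (S j) = binom l j + binom l (S j).
Proof.
  unfold binom.
  destruct (Nat.leb_spec (S j) (S l)) as [H1 | H1];
  destruct (Nat.leb_spec j l) as [H2 | H2];
  destruct (Nat.leb_spec (S j) l) as [H3 | H3]; try lia; try lra.
  - symmetry; apply pascal; lia.
  - replace j with l by lia; rewrite !C_n_n; lra.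
Qed.

Lemma one_minus_pow (k l : nat) (z : C) : (l <= k)%nat ->
  sum_n (fun j => (RtoC ((-1) ^ j * binom l j) * z ^ j)%C) k
  = ((RtoC 1 - z) ^ l)%C.
Proof.
  set (t := fun l j => (RtoC ((-1) ^ j * binom l j) * z ^ j)%C).
  change ((l <= k)%nat -> sum_n (t l) k = ((RtoC 1 - z) ^ l)%C).
  assert (Ht : forall l k, sum_n (t (S l)) k
      = (sum_n (t l) k - z * (sum_n (t l) k - t l k))%C).
  { intros l0 k0; induction k0 as [|k0 IH].
    - rewrite !sum_O; unfold t; rewrite !binom_0; C_ring.
    - rewrite !sum_Sn, IH.
      change (@plus _) with Cplus; unfold t at 3 4 6 7.
      rewrite binom_SS; unfold t; simpl; rewrite ?RtoC_mult, ?RtoC_plus; C_ring. }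
  induction l as [|l IH]; intros Hl.
  - clear Hl Ht; induction k as [|k IH].
    + rewrite sum_O; unfold t; rewrite binom_0; simpl; rewrite !Rmult_1_r; C_ring.
    + rewrite sum_Sn, IH; unfold t; rewrite binom_gt by lia.
      change (@plus _) with Cplus; rewrite Rmult_0_r; simpl; C_ring.
  - rewrite Ht, IH by lia.
    replace (t l k) with (RtoC 0)
      by (unfold t; rewrite binom_gt by lia; rewrite Rmult_0_r; C_ring).
    simpl; C_ring.
Qed.

Lemma bdf_delta_symbol (k : nat) (z : C) :
  sum_n (fun j => (RtoC (bdf_delta k j) * z ^ j)%C) k = bdf_symbol k z.
Proof.
  unfold bdf_delta, bdf_symbol.
  assert (H : forall m, (m <= k)%nat ->
    sum_n (fun j => (RtoC (sum_n_m
      (fun l => / INR l * ((-1) ^ j * binom l j))%R 1 m) * z ^ j)%C) k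
    = sum_n_m (fun l => (RtoC (/ INR l) * (RtoC 1 - z) ^ l)%C) 1 m);
    [| now apply H].
  induction m as [|m IH]; intros Hm.
  - rewrite (sum_n_ext _ (fun _ => zero)).
    + unfold sum_n; rewrite sum_n_m_const_zero, sum_n_m_zero; auto; lia.
    + intros j; rewrite sum_n_m_zero by lia.
      change (@eq C (RtoC 0 * z ^ j)%C (RtoC 0)); ring.
  - rewrite (sum_n_Sm (G := C_AbelianMonoid)), <- IH by lia.
    rewrite <- (one_minus_pow k (S m) z Hm).
    rewrite <- (sum_n_mult_l (K := C_Ring)).
    unfold sum_n; rewrite <- sum_n_m_plus; apply sum_n_m_ext; intros j.
    rewrite (sum_n_Sm (G := R_AbelianMonoid)) by lia.
    change (@plus R_AbelianMonoid) with Rplus; rewrite RtoC_plus, RtoC_mult.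
    change (@plus _) with Cplus; change (@mult _) with Cmult; C_ring.
Qed.

(* Main.v *)
Require Import Defs.
From Stdlib Require Import Reals List Lra Lia ZArith ClassicalEpsilon.
From Coquelicot Require Import Coquelicot.

Open Scope R_scope.

(* Write [M z] for [A (delta z / tau - A)^-1], bounded for [|z| < 1] by the resolvent
   estimate, since [delta z / tau] stays in the sector.  With [P z = sum_(i <= n) u_i z^i],
   the scheme says that [A (P z) = sum_l z^l M z g_l] with [g_l = f_l] for [k <= l <= n],
   [g_l = 0] for [l < k], so [A u_n] is the sum of the coefficients of [z^(n-l)] in
   [M z g_l].  These are computed as averages of [z^-(n-l) M z] over the [m]-th roots of
   unity on a circle, [m] tending to infinity: for a function with a uniform second-order
   Taylor bound the average over a circle of radius [r] does not depend on [r] up to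
   [O(1/m)] (a discrete Cauchy theorem), so no vector-valued integral is needed.
   By the resolvent identity and [|delta z| >= c |1 - z|], the second difference of [M]
   under a rotation by [w] is [O(|1 - w|^2 / |1 - z|^2)].  The average of [|1 - z|^-2] is
   that of a Poisson kernel, at most a multiple of [1 / (1 - r^2)], and summation by parts
   with [r = 1 - 1 / (2 i)] bounds the [i]-th coefficient of [M] by [C / i].  Young's
   inequality and [1 + 1/2 + ... + 1/N <= 1 + log N] conclude.  The lower bound
   [|delta z| >= c |1 - z|] on the closed unit disc is the zero-stability of the method,
   certified by an explicit polynomial multiple of [delta z / (1 - z)] whose constant
   coefficient dominates the sum of the others. *)

(** * Zero-stability *)

(** The logarithm is the price of an arbitrary Banach space: the bound [C / i] on the coefficients
    of [M] is not summable, and no cancellation between them can be exploited. First differences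
    would give less: they are [O(|1 - w| / |1 - z|)], and [1 / |1 - z|] averages to the order of
    [log (1 / (1 - r))], so that [(log i) / i] would result. Second differences average to the order
    of [i |1 - w|^2] and are divided by [(i |1 - w|)^2]. The rotation [w] is one step of the grid,
    so the averages are exactly invariant under it, and its size drops out of the quotient. The
    bounds on [M] and on its second differences are homogeneous of degree 0 in [delta z / tau], so
    [tau] cancels. Cutting [u] off at [n] makes [P] a polynomial, so no growth of [u] has to be
    controlled. The cut creates spurious residuals [g_l] for [n < l <= n + k]; they do not reach the
    coefficient of [z^n], since [z^(l-n) M z g_l] averages to nearly 0 on small circles. *)

Fixpoint int_poly (l : list Z) (z : C) : C :=
  match l with
  | nil => RtoC 0
  | cons a l => (RtoC (IZR a) + z * int_poly l z)%C
  end.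

(** The coefficients live in [Z] so that the dominance condition of a certificate is decided by
    computation. *)
Fixpoint int_poly_norm (l : list Z) : Z :=
  match l with
  | nil => 0%Z
  | cons a l => (Z.abs a + int_poly_norm l)%Z
  end.

Lemma int_poly_bound (l : list Z) (z : C) :
  Cmod z <= 1 -> Cmod (int_poly l z) <= IZR (int_poly_norm l).
Proof.
  intros Hz; induction l as [|a l IH]; simpl.
  - rewrite Cmod_0; lra.
  - rewrite plus_IZR, abs_IZR.
    apply Rle_trans with (1 := Cmod_triangle _ _).
    rewrite Cmod_R, Cmod_mult.
    assert (H := Cmod_ge_0 (int_poly l z)); assert (H' := Cmod_ge_0 z).
    assert (Cmod z * Cmod (int_poly l z) <= 1 * IZR (int_poly_norm l))
      by (apply Rmult_le_compat; lra).
    lra.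
Qed.

(** On the unit disc the right-hand side has modulus at least [a - |r|_1 >= 1], by integrality,
    while the left-hand side is at most [|s| |q|_1]. So [s] stays away from 0 without any root being
    located. *)
Lemma nonzero_certificate (s : C) (q r : list Z) (a : Z) (z : C) :
  Cmod z <= 1 -> (int_poly_norm r < a)%Z ->
  (s * int_poly q z)%C = (RtoC (IZR a) + z * int_poly r z)%C ->
  1 <= Cmod s * IZR (int_poly_norm q).
Proof.
  intros Hz Ha E.
  assert (Hq := int_poly_bound q z Hz).
  assert (Hr := int_poly_bound r z Hz).
  assert (H1 : 1 <= Cmod (s * int_poly q z)).
  { rewrite E.
    assert (Ht := Cmod_triangle (RtoC (IZR a) + z * int_poly r z)
                    (- (z * int_poly r z))).
    replace (RtoC (IZR a) + z * int_poly r z + - (z * int_poly r z))%C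
      with (RtoC (IZR a)) in Ht by ring.
    rewrite Cmod_R, Cmod_opp, Cmod_mult in Ht.
    assert (H := Cmod_ge_0 (int_poly r z)); assert (H' := Cmod_ge_0 z).
    assert (Cmod z * Cmod (int_poly r z) <= 1 * IZR (int_poly_norm r))
      by (apply Rmult_le_compat; lra).
    assert (Hz1 : (int_poly_norm r + 1 <= a)%Z) by lia.
    apply IZR_le in Hz1; rewrite plus_IZR in Hz1.
    assert (Haa := Rle_abs (IZR a)); lra. }
  rewrite Cmod_mult in H1.
  assert (Hs := Cmod_ge_0 s).
  apply Rle_trans with (1 := H1).
  now apply Rmult_le_compat_l.
Qed.

(** [d] clears the denominators of the symbol and [s] is the value of the cofactor of [1 - z]; the
    constant obtained is [1 / (d |q|_1)]. *)
Lemma zero_stability_of_certificate (k : nat) (d : R) (q r : list Z) (a : Z) :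
  0 < d -> (0 < int_poly_norm q)%Z -> (int_poly_norm r < a)%Z ->
  (forall z : C, exists s : C,
     (RtoC d * bdf_symbol k z)%C = ((RtoC 1 - z) * s)%C /\
     (s * int_poly q z)%C = (RtoC (IZR a) + z * int_poly r z)%C) ->
  exists c : R, 0 < c /\
    forall z : C, Cmod z <= 1 -> c * Cmod (RtoC 1 - z) <= Cmod (bdf_symbol k z).
Proof.
  intros Hd Hq Ha H.
  apply IZR_lt in Hq.
  exists (/ (d * IZR (int_poly_norm q))); split.
  { apply Rinv_0_lt_compat, Rmult_lt_0_compat; lra. }
  intros z Hz; destruct (H z) as [s [E1 E2]].
  assert (H1 := nonzero_certificate s q r a z Hz Ha E2).
  assert (E : d * Cmod (bdf_symbol k z) = Cmod (RtoC 1 - z) * Cmod s).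
  { rewrite <- Cmod_mult, <- E1, Cmod_mult, Cmod_R, Rabs_pos_eq; lra. }
  set (Q := IZR (int_poly_norm q)) in *.
  assert (Hw := Cmod_ge_0 (RtoC 1 - z)).
  apply Rmult_le_reg_l with (d * Q); [apply Rmult_lt_0_compat; lra|].
  rewrite <- Rmult_assoc, Rinv_r, Rmult_1_l by (apply Rgt_not_eq, Rmult_lt_0_compat; lra).
  replace (d * Q * Cmod (bdf_symbol k z)) with (Q * (d * Cmod (bdf_symbol k z))) by ring.
  rewrite E.
  replace (Q * (Cmod (RtoC 1 - z) * Cmod s)) with (Cmod (RtoC 1 - z) * (Cmod s * Q)) by ring.
  rewrite <- (Rmult_1_r (Cmod (RtoC 1 - z))) at 1.
  now apply Rmult_le_compat_l.
Qed.

(** [p] lists the coefficients of [d delta z / (1 - z)], constant term first; [q] is the multiplier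
    and [a + z r] the product of [p] and [q]. *)
Ltac bdf_certificate d p q r a :=
  apply (zero_stability_of_certificate _ d q r a);
  [ lra | reflexivity | reflexivity
  | intros z; exists (int_poly p z); split;
    [ unfold bdf_symbol;
      repeat (rewrite (sum_n_Sm (G := C_AbelianMonoid)) by lia); rewrite sum_n_m_zero by lia;
      change (@zero C_AbelianMonoid) with (RtoC 0);
      change (@plus C_AbelianMonoid) with Cplus; cbn [INR int_poly];
      rewrite ?RtoC_inv by lra; rewrite ?RtoC_plus;
      field;
      repeat split; rewrite <- ?RtoC_plus; intros E; injection E; lra
    | cbn [int_poly]; ring ] ].

(* The multipliers [q] were found by minimising the l^1 norm of the nonconstant part of
   the product. *)
Lemma bdf_zero_stable (k : nat) : (1 <= k <= 6)%nat ->
  exists c : R, 0 < c /\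
    forall z : C, Cmod z <= 1 -> c * Cmod (RtoC 1 - z) <= Cmod (bdf_symbol k z).
Proof.
  intros Hk.
  assert (H : (k = 1 \/ k = 2 \/ k = 3 \/ k = 4 \/ k = 5 \/ k = 6)%nat) by lia.
  destruct H as [H|[H|[H|[H|[H|H]]]]]; subst k.
  - bdf_certificate 1 (1 :: nil)%Z (1 :: nil)%Z (@nil Z) 1%Z.
  - bdf_certificate 2 (3 :: -1 :: nil)%Z (1 :: nil)%Z (-1 :: nil)%Z 3%Z.
  - bdf_certificate 6 (11 :: -7 :: 2 :: nil)%Z (1 :: nil)%Z (-7 :: 2 :: nil)%Z 11%Z.
  - bdf_certificate 12 (25 :: -23 :: 13 :: -3 :: nil)%Z (2 :: 1 :: nil)%Z
      (-21 :: 3 :: 7 :: -3 :: nil)%Z 50%Z.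
  - bdf_certificate 60 (137 :: -163 :: 137 :: -63 :: 12 :: nil)%Z (2 :: 2 :: 1 :: nil)%Z
      (-52 :: 85 :: -15 :: 35 :: -39 :: 12 :: nil)%Z 274%Z.
  - bdf_certificate 60 (147 :: -213 :: 237 :: -163 :: 62 :: -10 :: nil)%Z
      (7 :: 10 :: 5 :: nil)%Z
      (-21 :: 264 :: 164 :: -11 :: -265 :: 210 :: -50 :: nil)%Z 1029%Z.
Qed.

(** * Linear identities in modules *)

(** Proof by reflection for module identities: vectors become numbered atoms, whereas scalars stay
    arbitrary complex terms, so that the resulting coefficient identities can be given to [ring], or
    to [field] when powers of [z] cancel. *)
Inductive vexpr :=
  | VZero | VVar (n : nat) | VPlus (a b : vexpr) | VOpp (a : vexpr)
  | VScal (c : C) (a : vexpr).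

Fixpoint vdenote {V : NormedModule C_AbsRing} (env : list V) (e : vexpr) : V :=
  match e with
  | VZero => zero
  | VVar n => nth n env zero
  | VPlus a b => plus (vdenote env a) (vdenote env b)
  | VOpp a => opp (vdenote env a)
  | VScal c a => scal (c : C_AbsRing) (vdenote env a)
  end.

Fixpoint vcoef (e : vexpr) (i : nat) : C :=
  match e with
  | VZero => RtoC 0
  | VVar n => if Nat.eqb n i then RtoC 1 else RtoC 0
  | VPlus a b => (vcoef a i + vcoef b i)%C
  | VOpp a => (- vcoef a i)%C
  | VScal c a => (c * vcoef a i)%C
  end.

Fixpoint vcombine {V : NormedModule C_AbsRing} (c : nat -> C) (env : list V) : V :=
  match env with
  | nil => zero
  | cons x l => plus (scal (c 0%nat : C_AbsRing) x) (vcombine (fun i => c (S i)) l)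
  end.

(** Agreement on the indices of [env] only, by recursion, so that it unfolds to one equation per
    atom. *)
Fixpoint vagree {A : Type} (c d : nat -> C) (env : list A) : Prop :=
  match env with
  | nil => True
  | cons _ l => c 0%nat = d 0%nat /\ vagree (fun i => c (S i)) (fun i => d (S i)) l
  end.

Section VectorExpressions.

Context {V : NormedModule C_AbsRing}.
Implicit Types (env : list V) (c d : nat -> C).

Lemma vcombine_ext env : forall c d,
  vagree c d env -> vcombine c env = vcombine d env.
Proof.
  induction env as [|x l IH]; intros c d H; simpl in *; [reflexivity|].
  destruct H as [H1 H2]; rewrite H1, (IH _ _ H2); reflexivity.
Qed.

Lemma vagree_all env : forall c d, (forall i, c i = d i) -> vagree c d env.
Proof. induction env as [|x l IH]; intros c d H; simpl; auto. Qed.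

Lemma vcombine_zero env : vcombine (fun _ => RtoC 0) env = zero.
Proof.
  induction env as [|x l IH]; simpl; [reflexivity|].
  rewrite IH, plus_zero_r. exact (scal_zero_l x).
Qed.

Lemma vcombine_plus env : forall c d,
  vcombine (fun i => (c i + d i)%C) env = plus (vcombine c env) (vcombine d env).
Proof.
  induction env as [|x l IH]; intros c d; simpl; [now rewrite plus_zero_r|].
  rewrite IH.
  assert (E : scal (c 0%nat + d 0%nat : C_AbsRing)%C x
      = plus (scal (c 0%nat : C_AbsRing) x) (scal (d 0%nat : C_AbsRing) x))
    by exact (scal_distr_r (c 0%nat : C_AbsRing) (d 0%nat) x).
  rewrite E.
  rewrite <- !plus_assoc; f_equal.
  rewrite !plus_assoc; f_equal; apply plus_comm.
Qed.

Lemma vcombine_scal env : forall a c,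
  vcombine (fun i => (a * c i)%C) env = scal (a : C_AbsRing) (vcombine c env).
Proof.
  induction env as [|x l IH]; intros a c; simpl.
  - symmetry; exact (scal_zero_r (a : C_AbsRing)).
  - rewrite IH.
    assert (E : scal (a * c 0%nat : C_AbsRing)%C x
        = scal (a : C_AbsRing) (scal (c 0%nat : C_AbsRing) x))
      by (symmetry; exact (scal_assoc (a : C_AbsRing) (c 0%nat) x)).
    rewrite E; symmetry; exact (scal_distr_l (a : C_AbsRing) _ _).
Qed.

Lemma vdenote_combine env e : vdenote env e = vcombine (vcoef e) env.
Proof.
  induction e as [|n|a IHa b IHb|a IHa|c a IHa]; simpl.
  - symmetry; apply vcombine_zero.
  - revert n; induction env as [|x l IH]; intros n; simpl.
    { destruct n; reflexivity. }
    destruct n as [|n]; simpl.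
    + rewrite vcombine_zero, plus_zero_r; symmetry; exact (scal_one x).
    + rewrite IH.
      assert (E : scal (RtoC 0 : C_AbsRing) x = zero) by exact (scal_zero_l x).
      rewrite E, plus_zero_l; reflexivity.
  - now rewrite vcombine_plus, IHa, IHb.
  - rewrite IHa.
    assert (E : opp (vcombine (vcoef a) env)
        = scal (- RtoC 1 : C_AbsRing)%C (vcombine (vcoef a) env))
      by (symmetry; exact (scal_opp_one (K := C_AbsRing) _)).
    rewrite E, <- vcombine_scal.
    apply vcombine_ext, vagree_all; intros i; ring.
  - now rewrite vcombine_scal, IHa.
Qed.

Lemma vdenote_eq env e1 e2 :
  vagree (vcoef e1) (vcoef e2) env -> vdenote env e1 = vdenote env e2.
Proof. intros H; rewrite !vdenote_combine; now apply vcombine_ext. Qed.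

End VectorExpressions.

Ltac v_collect T env e :=
  lazymatch e with
  | @plus _ ?a ?b => let env := v_collect T env a in v_collect T env b
  | @minus _ ?a ?b => let env := v_collect T env a in v_collect T env b
  | @opp _ ?a => v_collect T env a
  | @scal _ _ _ ?a => v_collect T env a
  | @zero _ => env
  | ?x => lazymatch env with
          | context [@cons _ x _] => env
          | _ => constr:(@cons T x env)
          end
  end.

Ltac v_index env x :=
  lazymatch env with
  | @cons _ x _ => constr:(O)
  | @cons _ _ ?l => let n := v_index l x in constr:(S n)
  end.

Ltac v_reify env e :=
  lazymatch e with
  | @plus _ ?a ?b =>
      let a := v_reify env a in let b := v_reify env b in constr:(VPlus a b)
  | @minus _ ?a ?b =>
      let a := v_reify env a in let b := v_reify env b in constr:(VPlus a (VOpp b))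
  | @opp _ ?a => let a := v_reify env a in constr:(VOpp a)
  | @scal _ _ ?c ?a => let a := v_reify env a in constr:(VScal c a)
  | @zero _ => constr:(VZero)
  | ?x => let n := v_index env x in constr:(VVar n)
  end.

(* Reduces an equality of linear combinations in V to equalities of coefficients. *)
Ltac vec_eq V :=
  lazymatch goal with
  | |- ?a = ?b =>
      let T := constr:(NormedModule.sort C_AbsRing V) in
      let env := v_collect T (@nil T) a in
      let env := v_collect T env b in
      let ea := v_reify env a in
      let eb := v_reify env b in
      change (@vdenote V env ea = @vdenote V env eb);
      apply vdenote_eq; cbn [vagree vcoef Nat.eqb];
      change (@plus C_AbsRing) with Cplus; change (@mult C_AbsRing) with Cmult;
      change (@opp C_AbsRing) with Copp; change (@minus C_AbsRing) with Cminus;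
      repeat split
  end.

Ltac vec V := vec_eq V; ring.

(** * Functions with a uniform first-order expansion *)

Lemma norm_scal_le {V : NormedModule C_AbsRing} (c : C) (x : V) (p q : R) :
  Cmod c <= p -> norm x <= q -> norm (scal (c : C_AbsRing) x) <= p * q.
Proof.
  intros Hc Hx; apply Rle_trans with (1 := norm_scal (c : C_AbsRing) x).
  apply Rmult_le_compat; auto; [apply Cmod_ge_0 | apply norm_ge_0].
Qed.

Lemma norm_plus_le {V : NormedModule C_AbsRing} (x y : V) (p q : R) :
  norm x <= p -> norm y <= q -> norm (plus x y) <= p + q.
Proof. intros Hx Hy; assert (H := norm_triangle x y); lra. Qed.

Lemma norm_minus_le {V : NormedModule C_AbsRing} (x y : V) (p q : R) :
  norm x <= p -> norm y <= q -> norm (minus x y) <= p + q.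
Proof. intros Hx Hy; apply norm_plus_le; [|rewrite norm_opp]; auto. Qed.

Lemma norm_eq_le {V : NormedModule C_AbsRing} (x y : V) (b : R) :
  x = y -> norm y <= b -> norm x <= b.
Proof. now intros ->. Qed.

Lemma norm_minus_diag {V : NormedModule C_AbsRing} (x : V) : norm (minus x x) = 0.
Proof.
  transitivity (norm (@zero V)); [|exact norm_zero].
  apply f_equal; vec V.
Qed.

Lemma norm_scal_cancel {V : NormedModule C_AbsRing} (c : C) (x : V) (q : R) :
  c <> RtoC 0 -> norm (scal (c : C_AbsRing) x) <= q -> norm x <= q / Cmod c.
Proof.
  intros Hc H.
  assert (E : x = scal (/ c : C_AbsRing)%C (scal (c : C_AbsRing) x))
    by (vec_eq V; field; auto).
  assert (Hp : 0 < Cmod c) by (now apply Cmod_gt_0).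
  rewrite E; unfold Rdiv; rewrite Rmult_comm.
  apply norm_scal_le; auto.
  rewrite Cmod_inv by auto; lra.
Qed.

(** A quantitative complex differentiability: [G'] is a derivative with quadratic remainder, and one
    constant serves all pairs of points. The bounds relate two points of [D] directly, so annuli,
    which are not convex, cause no trouble. *)
Definition smooth {V : NormedModule C_AbsRing} (D : C -> Prop) (G : C -> V) : Prop :=
  exists (G' : C -> V) (B : R), 0 <= B /\ forall z w, D z -> D w ->
    norm (G z) <= B /\ norm (G' z) <= B /\
    norm (minus (G w) (G z)) <= B * Cmod (w - z) /\
    norm (minus (minus (G w) (G z)) (scal (w - z : C_AbsRing)%C (G' z)))
      <= B * Cmod (w - z) ^ 2.

(** [smooth] for the space [C] itself, spelled out with [Cmod] and the field operations; the two are
    convertible, so the lemmas on [smooth] apply at [C_NormedModule]. *)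
Definition Csmooth (D : C -> Prop) (a : C -> C) : Prop :=
  exists (a' : C -> C) (B : R), 0 <= B /\ forall z w, D z -> D w ->
    Cmod (a z) <= B /\ Cmod (a' z) <= B /\
    Cmod (a w - a z) <= B * Cmod (w - z) /\
    Cmod (a w - a z - (w - z) * a' z) <= B * Cmod (w - z) ^ 2.

Lemma smooth_ext {V : NormedModule C_AbsRing} (D : C -> Prop) (G H : C -> V) :
  (forall z, D z -> G z = H z) -> smooth D G -> smooth D H.
Proof.
  intros E [G' [B [HB HG]]]; exists G', B; split; auto.
  intros z w Hz Hw; rewrite <- !E by auto; auto.
Qed.

Lemma smooth_sub {V : NormedModule C_AbsRing} (D E : C -> Prop) (G : C -> V) :
  (forall z, E z -> D z) -> smooth D G -> smooth E G.
Proof.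
  intros HE [G' [B [HB HG]]]; exists G', B; split; auto.
Qed.

(** Product rule: the remainder is that of [a] times [G z], plus [a z] times that of [G], plus the
    product of the two increments; hence the factor 3. *)
Lemma smooth_scal {V : NormedModule C_AbsRing} (D : C -> Prop) (a : C -> C) (G : C -> V) :
  Csmooth D a -> smooth D G -> smooth D (fun z => scal (a z : C_AbsRing) (G z)).
Proof.
  intros [a' [A [HA Ha]]] [G' [B [HB HG]]].
  exists (fun z => plus (scal (a' z : C_AbsRing) (G z)) (scal (a z : C_AbsRing) (G' z))).
  exists (3 * (A * B)); assert (HAB := Rmult_le_pos _ _ HA HB).
  split; [lra|]; intros z w Hz Hw.
  destruct (Ha z w Hz Hw) as [a1 [a2 [a3 a4]]].
  destruct (HG z w Hz Hw) as [g1 [g2 [g3 g4]]].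
  destruct (HG w z Hw Hz) as [h1 _].
  set (d := Cmod (w - z)) in *; assert (Hd : 0 <= d) by apply Cmod_ge_0.
  repeat split.
  - apply Rle_trans with (A * B); [apply norm_scal_le; auto | lra].
  - apply Rle_trans with (A * B + A * B);
      [apply norm_plus_le; apply norm_scal_le; auto | lra].
  - assert (Hp := Rmult_le_pos _ _ HAB Hd).
    apply Rle_trans with ((A * d) * B + A * (B * d)); [|lra].
    eapply norm_eq_le.
    2: { apply norm_plus_le; apply norm_scal_le;
         [exact a3 | exact h1 | exact a1 | exact g3]. }
    vec V.
  - apply Rle_trans with ((A * d ^ 2) * B + A * (B * d ^ 2) + (A * d) * (B * d)); [|lra].
    eapply norm_eq_le.
    2: { apply norm_plus_le; [apply norm_plus_le|]; apply norm_scal_le;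
         [exact a4 | exact g1 | exact a1 | exact g4 | exact a3 | exact g3]. }
    vec V.
Qed.

Lemma smooth_comp {V : NormedModule C_AbsRing} (D S : C -> Prop) (a : C -> C) (G : C -> V) :
  (forall z, D z -> S (a z)) -> Csmooth D a -> smooth S G -> smooth D (fun z => G (a z)).
Proof.
  intros HS [a' [A [HA Ha]]] [G' [B [HB HG]]].
  exists (fun z => scal (a' z : C_AbsRing) (G' (a z))).
  exists (B + A * B + B * A ^ 2).
  assert (HAB := Rmult_le_pos _ _ HA HB).
  assert (HAA := Rmult_le_pos _ _ HB (pow2_ge_0 A)).
  split; [lra|]; intros z w Hz Hw.
  destruct (Ha z w Hz Hw) as [a1 [a2 [a3 a4]]].
  destruct (HG (a z) (a w) (HS _ Hz) (HS _ Hw)) as [g1 [g2 [g3 g4]]].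
  set (d := Cmod (w - z)) in *; assert (Hd : 0 <= d) by apply Cmod_ge_0.
  assert (He := Cmod_ge_0 (a w - a z)).
  repeat split.
  - lra.
  - apply Rle_trans with (A * B); [apply norm_scal_le; auto | lra].
  - apply Rle_trans with (1 := g3).
    apply Rle_trans with (B * (A * d)); [apply Rmult_le_compat_l; auto|].
    assert (H1 := Rmult_le_pos _ _ HB Hd); assert (H2 := Rmult_le_pos _ _ HAA Hd); lra.
  - assert (H1 : Cmod (a w - a z) ^ 2 <= A ^ 2 * d ^ 2).
    { rewrite <- Rpow_mult_distr; apply pow_incr; split; auto. }
    apply Rle_trans with (B * (A ^ 2 * d ^ 2) + (A * d ^ 2) * B).
    + eapply norm_eq_le.
      2: { apply norm_plus_le.
           - apply Rle_trans with (1 := g4); apply Rmult_le_compat_l; eauto.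
           - apply norm_scal_le; [exact a4 | exact g2]. }
      vec V.
    + assert (H2 := Rmult_le_pos _ _ HB (pow2_ge_0 d)); lra.
Qed.

Lemma Csmooth_const (D : C -> Prop) (c : C) : Csmooth D (fun _ => c).
Proof.
  exists (fun _ => RtoC 0), (Cmod c); assert (Hc := Cmod_ge_0 c).
  split; auto; intros z w _ _.
  replace (c - c - (w - z) * 0)%C with (RtoC 0) by ring.
  replace (c - c)%C with (RtoC 0) by ring.
  rewrite Cmod_0; assert (H := Cmod_ge_0 (w - z)); repeat split; auto; try lra.
  - now apply Rmult_le_pos.
  - apply Rmult_le_pos; auto; apply pow2_ge_0.
Qed.

Lemma Csmooth_id (D : C -> Prop) (b : R) :
  (forall z, D z -> Cmod z <= b) -> Csmooth D (fun z => z).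
Proof.
  intros H; exists (fun _ => RtoC 1), (Rmax 1 b).
  assert (H1 := Rmax_l 1 b); assert (H2 := Rmax_r 1 b).
  split; [lra|]; intros z w Hz Hw.
  replace (w - z - (w - z) * 1)%C with (RtoC 0) by ring.
  rewrite Cmod_0, Cmod_1; assert (Hd := Cmod_ge_0 (w - z)).
  assert (Hb := H z Hz).
  repeat split; try lra.
  - rewrite <- (Rmult_1_l (Cmod (w - z))) at 1; apply Rmult_le_compat_r; lra.
  - apply Rmult_le_pos; [lra | apply pow2_ge_0].
Qed.

Lemma Csmooth_plus (D : C -> Prop) (a b : C -> C) :
  Csmooth D a -> Csmooth D b -> Csmooth D (fun z => a z + b z)%C.
Proof.
  intros [a' [A [HA Ha]]] [b' [B [HB Hb]]].
  exists (fun z => a' z + b' z)%C, (A + B); split; [lra|]; intros z w Hz Hw.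
  destruct (Ha z w Hz Hw) as [a1 [a2 [a3 a4]]].
  destruct (Hb z w Hz Hw) as [b1 [b2 [b3 b4]]].
  repeat split.
  - apply Rle_trans with (1 := Cmod_triangle _ _); lra.
  - apply Rle_trans with (1 := Cmod_triangle _ _); lra.
  - replace (a w + b w - (a z + b z))%C with ((a w - a z) + (b w - b z))%C by ring.
    apply Rle_trans with (1 := Cmod_triangle _ _); lra.
  - replace (a w + b w - (a z + b z) - (w - z) * (a' z + b' z))%C
      with ((a w - a z - (w - z) * a' z) + (b w - b z - (w - z) * b' z))%C by ring.
    apply Rle_trans with (1 := Cmod_triangle _ _); lra.
Qed.

Lemma Csmooth_mult (D : C -> Prop) (a b : C -> C) :
  Csmooth D a -> Csmooth D b -> Csmooth D (fun z => a z * b z)%C.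
Proof. intros Ha Hb; exact (smooth_scal (V := C_NormedModule) D a b Ha Hb). Qed.

Lemma Csmooth_pow (D : C -> Prop) (a : C -> C) (n : nat) :
  Csmooth D a -> Csmooth D (fun z => a z ^ n)%C.
Proof.
  intros Ha; induction n as [|n IH].
  - exact (Csmooth_const D (RtoC 1)).
  - exact (Csmooth_mult D a _ Ha IH).
Qed.

(** Composition with the inversion on [c <= |u|], whose remainder is exactly
    [(w - z)^2 / (w z^2)]. *)
Lemma Csmooth_inv (D : C -> Prop) (a : C -> C) (c : R) :
  0 < c -> (forall z, D z -> c <= Cmod (a z)) -> Csmooth D a ->
  Csmooth D (fun z => / a z)%C.
Proof.
  intros Hc Hca Ha.
  apply (smooth_comp (V := C_NormedModule) D (fun u => c <= Cmod u) a Cinv Hca Ha).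
  change (Csmooth (fun u => c <= Cmod u) Cinv).
  exists (fun u => - (/ u * / u))%C, (/ c + / c ^ 2 + / c ^ 3).
  assert (P1 : 0 < / c) by now apply Rinv_0_lt_compat.
  assert (P2 : 0 < / c ^ 2) by now apply Rinv_0_lt_compat, pow_lt.
  assert (P3 : 0 < / c ^ 3) by now apply Rinv_0_lt_compat, pow_lt.
  split; [lra|].
  assert (I : forall u, c <= Cmod u -> u <> RtoC 0 /\ Cmod (/ u) <= / c).
  { intros u Hu; assert (Hu0 : u <> RtoC 0) by (apply Cmod_gt_0; lra).
    split; auto; rewrite Cmod_inv by auto; apply Rinv_le_contravar; auto. }
  intros z w Hz Hw.
  destruct (I z Hz) as [z0 z1]; destruct (I w Hw) as [w0 w1].
  assert (Nz := Cmod_ge_0 (/ z)); assert (Nw := Cmod_ge_0 (/ w)).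
  assert (Hd := Cmod_ge_0 (w - z)).
  assert (Q : forall p q, 0 <= p -> p <= / c -> 0 <= q -> q <= / c ->
      0 <= p * q <= / c ^ 2).
  { intros p q Hp Hp' Hq Hq'; split; [apply Rmult_le_pos; lra|].
    replace (/ c ^ 2) with (/ c * / c) by (field; lra).
    apply Rmult_le_compat; lra. }
  repeat split.
  - lra.
  - rewrite Cmod_opp, Cmod_mult; destruct (Q (Cmod (/ z)) (Cmod (/ z))); auto; lra.
  - replace (/ w - / z)%C with (- ((w - z) * (/ w * / z)))%C by (field; auto).
    rewrite Cmod_opp, !Cmod_mult, Rmult_comm.
    apply Rmult_le_compat_r; auto.
    destruct (Q (Cmod (/ w)) (Cmod (/ z))); auto; lra.
  - replace (/ w - / z - (w - z) * - (/ z * / z))%C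
      with ((w - z) ^ 2 * ((/ w * / z) * / z))%C by (simpl; field; auto).
    rewrite !Cmod_mult, Cmod_pow, Rmult_comm.
    apply Rmult_le_compat_r; [apply pow2_ge_0|].
    destruct (Q (Cmod (/ w)) (Cmod (/ z))) as [q1 q2]; auto.
    apply Rle_trans with (/ c ^ 2 * / c); [apply Rmult_le_compat; lra|].
    replace (/ c ^ 2 * / c) with (/ c ^ 3) by (field; lra); lra.
Qed.

Ltac C_eq := match goal with |- ?a = ?b => change (@eq C a b) end.

Lemma Csmooth_bdf (k : nat) : Csmooth (fun z => Cmod z <= 1) (bdf_symbol k).
Proof.
  set (D := fun z => Cmod z <= 1).
  assert (H1 : Csmooth D (fun z => RtoC 1 - z)%C).
  { apply (smooth_ext (V := C_NormedModule) D (fun z => RtoC 1 + RtoC (-1) * z)%C).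
    - intros z _; C_eq; ring.
    - apply Csmooth_plus; [apply Csmooth_const|].
      apply Csmooth_mult; [apply Csmooth_const | apply (Csmooth_id D 1); auto]. }
  unfold bdf_symbol; induction k as [|k IH].
  - apply (smooth_ext (V := C_NormedModule) D (fun z => RtoC 0)); [|apply Csmooth_const].
    intros z _; rewrite sum_n_m_zero by lia; reflexivity.
  - apply (smooth_ext (V := C_NormedModule) D (fun z =>
      sum_n_m (fun l => (RtoC (/ INR l) * (RtoC 1 - z) ^ l)%C) 1 k
      + RtoC (/ INR (S k)) * (RtoC 1 - z) ^ S k)%C).
    + intros z _; symmetry; exact (sum_n_Sm _ 1 k ltac:(lia)).
    + apply Csmooth_plus; [exact IH|].
      apply Csmooth_mult; [apply Csmooth_const | now apply Csmooth_pow].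
Qed.

(** * Averages over roots of unity *)

(** The root of unity of order [p + 1]; the shift keeps the order positive. *)
Definition rot (p : nat) : C :=
  (cos (2 * PI / INR (S p)), sin (2 * PI / INR (S p))).

Lemma INR_S_pos (p : nat) : 0 < INR (S p).
Proof. apply lt_0_INR; lia. Qed.

Lemma rot_pow (p j : nat) :
  (rot p ^ j)%C = (cos (INR j * (2 * PI / INR (S p))), sin (INR j * (2 * PI / INR (S p)))).
Proof.
  unfold rot; set (t := 2 * PI / INR (S p)).
  induction j as [|j IH].
  - simpl; rewrite Rmult_0_l, cos_0, sin_0; reflexivity.
  - rewrite Cpow_S, IH, S_INR.
    replace ((INR j + 1) * t) with (t + INR j * t) by ring.
    rewrite cos_plus, sin_plus; unfold Cmult; simpl; f_equal; ring.
Qed.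

Lemma rot_period (p : nat) : (rot p ^ S p)%C = RtoC 1.
Proof.
  rewrite rot_pow.
  replace (INR (S p) * (2 * PI / INR (S p))) with (2 * PI)
    by (field; apply Rgt_not_eq, INR_S_pos).
  now rewrite cos_2PI, sin_2PI.
Qed.

Lemma Cmod_rot (p : nat) : Cmod (rot p) = 1.
Proof.
  unfold rot, Cmod; cbn [fst snd].
  set (t := 2 * PI / INR (S p)).
  replace (cos t ^ 2 + sin t ^ 2) with (Rsqr (sin t) + Rsqr (cos t)) by (unfold Rsqr; ring).
  now rewrite sin2_cos2, sqrt_1.
Qed.

Lemma Cmod_rot_pow (p j : nat) : Cmod (rot p ^ j) = 1.
Proof. rewrite Cmod_pow, Cmod_rot; apply pow1. Qed.

Lemma Cmod_circle (p j : nat) (r : R) : 0 <= r -> Cmod (RtoC r * rot p ^ j) = r.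
Proof.
  intros Hr; rewrite Cmod_mult, Cmod_R, Cmod_rot_pow, Rabs_pos_eq; lra.
Qed.

Lemma rot_minus_1 (p : nat) :
  Cmod (rot p - 1) = 2 * sin (PI / INR (S p)).
Proof.
  set (s := PI / INR (S p)).
  assert (Hs : 0 <= sin s).
  { assert (Hp := INR_S_pos p); assert (HPI := PI_RGT_0).
    apply sin_ge_0; unfold s.
    - apply Rlt_le, Rdiv_lt_0_compat; lra.
    - apply Rmult_le_reg_r with (INR (S p)); auto.
      unfold Rdiv; rewrite Rmult_assoc, Rinv_l, Rmult_1_r by lra.
      rewrite <- (Rmult_1_r PI) at 1; apply Rmult_le_compat_l; [lra|].
      apply (le_INR 1); lia. }
  assert (E : (rot p - 1)%C = (- (2 * sin s * sin s), 2 * sin s * cos s)).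
  { unfold rot.
    replace (2 * PI / INR (S p)) with (2 * s)
      by (unfold s; field; apply Rgt_not_eq, INR_S_pos).
    rewrite cos_2a_sin, sin_2a.
    unfold Cminus, Cplus, Copp, RtoC; cbn [fst snd]; f_equal; ring. }
  rewrite E; unfold Cmod; cbn [fst snd].
  replace ((- (2 * sin s * sin s)) ^ 2 + (2 * sin s * cos s) ^ 2)
    with ((2 * sin s) ^ 2 * (Rsqr (sin s) + Rsqr (cos s))) by (unfold Rsqr; ring).
  rewrite sin2_cos2, Rmult_1_r, sqrt_pow2; lra.
Qed.

Lemma rot_near_1 (p : nat) : Cmod (rot p - 1) <= 2 * PI / INR (S p).
Proof.
  rewrite rot_minus_1.
  assert (H : 0 < PI / INR (S p))
    by (apply Rdiv_lt_0_compat; [apply PI_RGT_0 | apply INR_S_pos]).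
  apply sin_lt_x in H.
  replace (2 * PI / INR (S p)) with (2 * (PI / INR (S p)))
    by (field; apply Rgt_not_eq, INR_S_pos).
  lra.
Qed.

Lemma rot_neq_1 (p : nat) : (1 <= p)%nat -> 0 < Cmod (rot p - 1).
Proof.
  intros Hp; rewrite rot_minus_1.
  assert (HPI := PI_RGT_0).
  assert (H : 1 < INR (S p)) by (apply (lt_INR 1); lia).
  assert (0 < sin (PI / INR (S p))); [|lra].
  apply sin_gt_0.
  - apply Rdiv_lt_0_compat; lra.
  - apply Rmult_lt_reg_r with (INR (S p)); [lra|].
    unfold Rdiv; rewrite Rmult_assoc, Rinv_l, Rmult_1_r by lra.
    rewrite <- (Rmult_1_r PI) at 1; apply Rmult_lt_compat_l; lra.
Qed.

Lemma eventually_small (c e : R) : 0 < e -> eventually (fun p => c / INR (S p) <= e).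
Proof.
  intros He; destruct (INR_archimed e c He) as [n Hn].
  exists n; intros p Hp.
  assert (H := INR_S_pos p); apply Rmult_le_reg_r with (INR (S p)); auto.
  unfold Rdiv; rewrite Rmult_assoc, Rinv_l, Rmult_1_r by lra.
  apply le_INR in Hp; rewrite S_INR.
  assert (e * INR n <= e * INR p) by (apply Rmult_le_compat_l; lra); lra.
Qed.

Lemma eventually_rot_near (e : R) : 0 < e -> eventually (fun p => Cmod (rot p - 1) <= e).
Proof.
  intros He; generalize (eventually_small (2 * PI) e He); apply filter_imp.
  intros p Hp; assert (H := rot_near_1 p); lra.
Qed.

Lemma eventually_ge (n : nat) : eventually (fun p => (n <= p)%nat).
Proof. now exists n. Qed.

(** * Discrete averages and their linearity *)

Definition avg {V : NormedModule C_AbsRing} (p : nat) (g : nat -> V) : V :=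
  scal (RtoC (/ INR (S p)) : C_AbsRing) (sum_n g p).

Definition ravg (p : nat) (g : nat -> R) : R := / INR (S p) * sum_n g p.

Lemma sum_n_rotate {G : AbelianMonoid} (g : nat -> G) (p : nat) :
  g (S p) = g 0%nat -> sum_n (fun j => g (S j)) p = sum_n g p.
Proof.
  intros H; unfold sum_n; rewrite sum_n_m_S.
  rewrite (sum_n_Sm g 1 p) by lia.
  rewrite (sum_Sn_m g 0 p) by lia.
  now rewrite H, plus_comm.
Qed.

Section Averages.

Context {V : NormedModule C_AbsRing}.
Implicit Types g h : nat -> V.

Lemma avg_ext (p : nat) g h : (forall j, g j = h j) -> avg p g = avg p h.
Proof. intros E; unfold avg; f_equal; now apply sum_n_ext. Qed.

Lemma avg_rotate (p : nat) g :
  g (S p) = g 0%nat -> avg p (fun j => g (S j)) = avg p g.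
Proof. intros H; unfold avg; f_equal; exact (sum_n_rotate g p H). Qed.

Lemma avg_plus (p : nat) g h :
  avg p (fun j => plus (g j) (h j)) = plus (avg p g) (avg p h).
Proof.
  unfold avg; rewrite sum_n_plus.
  exact (scal_distr_l (RtoC (/ INR (S p)) : C_AbsRing) _ _).
Qed.

Lemma avg_scal (p : nat) (c : C) g :
  avg p (fun j => scal (c : C_AbsRing) (g j)) = scal (c : C_AbsRing) (avg p g).
Proof.
  unfold avg.
  transitivity (scal (RtoC (/ INR (S p)) : C_AbsRing) (scal (c : C_AbsRing) (sum_n g p))).
  - apply f_equal; exact (sum_n_m_scal_l (c : C_AbsRing) g 0 p).
  - vec V.
Qed.

Lemma avg_minus (p : nat) g h :
  avg p (fun j => minus (g j) (h j)) = minus (avg p g) (avg p h).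
Proof.
  transitivity (avg p (fun j => plus (g j) (scal (RtoC (-1) : C_AbsRing) (h j)))).
  - apply avg_ext; intros j; vec V.
  - rewrite avg_plus, avg_scal; vec V.
Qed.

Lemma avg_sum (p n : nat) (g : nat -> nat -> V) :
  avg p (fun j => sum_n (fun l => g l j) n) = sum_n (fun l => avg p (g l)) n.
Proof.
  induction n as [|n IH].
  - rewrite sum_O; apply avg_ext; intros j; now rewrite sum_O.
  - rewrite sum_Sn, <- IH.
    transitivity (avg p (fun j => plus (sum_n (fun l => g l j) n) (g (S n) j))).
    + apply avg_ext; intros j; now rewrite sum_Sn.
    + now rewrite avg_plus.
Qed.

Lemma avg_norm_ravg (p : nat) g : norm (avg p g) <= ravg p (fun j => norm (g j)).
Proof.
  assert (Hp := Rlt_le _ _ (Rinv_0_lt_compat _ (INR_S_pos p))).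
  unfold avg, ravg; apply norm_scal_le.
  - rewrite Cmod_R, Rabs_pos_eq; lra.
  - apply norm_sum_n_m.
Qed.

End Averages.

Lemma ravg_le (p : nat) (g h : nat -> R) :
  (forall j, g j <= h j) -> ravg p g <= ravg p h.
Proof.
  intros H; assert (Hp := Rlt_le _ _ (Rinv_0_lt_compat _ (INR_S_pos p))).
  unfold ravg; apply Rmult_le_compat_l; auto; now apply sum_n_m_le.
Qed.

Lemma ravg_const (p : nat) (b : R) : ravg p (fun _ => b) = b.
Proof.
  unfold ravg; rewrite sum_n_const; field; apply Rgt_not_eq, INR_S_pos.
Qed.

Lemma ravg_plus (p : nat) (g h : nat -> R) :
  ravg p (fun j => g j + h j) = ravg p g + ravg p h.
Proof.
  unfold ravg; rewrite <- Rmult_plus_distr_l; f_equal; exact (sum_n_plus g h p).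
Qed.

Lemma ravg_mult (p : nat) (c : R) (g : nat -> R) :
  ravg p (fun j => c * g j) = c * ravg p g.
Proof.
  assert (E : sum_n (fun j => c * g j) p = c * sum_n g p)
    by exact (sum_n_mult_l (K := R_Ring) c g p).
  unfold ravg; rewrite E; ring.
Qed.

Lemma ravg_rotate (p : nat) (g : nat -> R) :
  g (S p) = g 0%nat -> ravg p (fun j => g (S j)) = ravg p g.
Proof. intros H; unfold ravg; f_equal; exact (sum_n_rotate g p H). Qed.

Lemma avg_norm_le {V : NormedModule C_AbsRing} (p : nat) (g : nat -> V) (b : R) :
  (forall j, norm (g j) <= b) -> norm (avg p g) <= b.
Proof.
  intros H; apply Rle_trans with (1 := avg_norm_ravg p g).
  rewrite <- (ravg_const p b); now apply ravg_le.
Qed.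

(** * A discrete Cauchy theorem on circles *)

Definition cavg {V : NormedModule C_AbsRing} (p : nat) (r : R) (G : C -> V) : V :=
  avg p (fun j => G (RtoC r * rot p ^ j)%C).

Lemma circle_rotate (p j : nat) (r : R) :
  (RtoC r * rot p ^ S j)%C = (rot p * (RtoC r * rot p ^ j))%C.
Proof. rewrite Cpow_S; ring. Qed.

Lemma circle_period (p : nat) (r : R) :
  (RtoC r * rot p ^ S p)%C = (RtoC r * rot p ^ 0)%C.
Proof. rewrite rot_period; reflexivity. Qed.

(** One grid step only permutes the nodes. This exact invariance takes the place of the rotation
    invariance of the integral. *)
Lemma cavg_rotate {V : NormedModule C_AbsRing} (p : nat) (r : R) (G : C -> V) :
  cavg p r (fun z => G (rot p * z)%C) = cavg p r G.
Proof.
  unfold cavg.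
  rewrite <- (avg_rotate p (fun j => G (RtoC r * rot p ^ j)%C)) by now rewrite circle_period.
  apply avg_ext; intros j; now rewrite circle_rotate.
Qed.

Lemma cavg_ext {V : NormedModule C_AbsRing} (p : nat) (r : R) (G H : C -> V) :
  0 <= r -> (forall z, Cmod z = r -> G z = H z) -> cavg p r G = cavg p r H.
Proof. intros Hr E; apply avg_ext; intros j; apply E; now apply Cmod_circle. Qed.

Lemma cavg_norm_le {V : NormedModule C_AbsRing} (p : nat) (r : R) (G : C -> V) (b : R) :
  0 <= r -> (forall z, Cmod z = r -> norm (G z) <= b) -> norm (cavg p r G) <= b.
Proof. intros Hr E; apply avg_norm_le; intros j; apply E; now apply Cmod_circle. Qed.

Definition annulus (r1 r2 : R) (z : C) : Prop := r1 <= Cmod z <= r2.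

(* The averages of the derivative in the angular direction telescope to 0, up to second
   order; hence so does, to first order, the radial derivative of the average. *)
Lemma cavg_radial_step {V : NormedModule C_AbsRing} (D : C -> Prop) (G G' : C -> V)
    (B s h : R) (p : nat) :
  0 < s -> 0 <= h -> 0 <= B -> (1 <= p)%nat ->
  (forall z, Cmod z = s \/ Cmod z = s + h -> D z) ->
  (forall z w, D z -> D w ->
    norm (minus (minus (G w) (G z)) (scal (w - z : C_AbsRing)%C (G' z)))
      <= B * Cmod (w - z) ^ 2) ->
  norm (minus (cavg p (s + h) G) (cavg p s G))
    <= B * h * (s * Cmod (rot p - 1) + h).
Proof.
  intros Hs Hh HB Hp HD HG.
  (* [X] is the average of the radial derivatives. The increments [G (rot p * z) - G z] average to
     0, so [c X] is, up to sign, the average of second-order remainders, each at most [B |c|^2];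
     dividing by [|c|] bounds [X]. *)
  set (X := avg p (fun j => scal (rot p ^ j : C_AbsRing)%C (G' (RtoC s * rot p ^ j)%C))).
  assert (Hrot := rot_neq_1 p Hp).
  assert (HX : norm X <= B * (s * Cmod (rot p - 1))).
  { set (c := (RtoC s * (rot p - 1))%C).
    assert (Hc : Cmod c = s * Cmod (rot p - 1))
      by (unfold c; rewrite Cmod_mult, Cmod_R, Rabs_pos_eq; lra).
    assert (Hc0 : 0 < Cmod c) by (rewrite Hc; apply Rmult_lt_0_compat; lra).
    rewrite <- Hc; replace (B * Cmod c) with ((B * Cmod c ^ 2) / Cmod c) by (field; lra).
    apply norm_scal_cancel; [now apply Cmod_gt_0|].
    apply norm_eq_le with (avg p (fun j => opp (minus
      (minus (G (RtoC s * rot p ^ S j)%C) (G (RtoC s * rot p ^ j)%C))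
      (scal (c : C_AbsRing)
        (scal (rot p ^ j : C_AbsRing)%C (G' (RtoC s * rot p ^ j)%C)))))).
    - transitivity (avg p (fun j => @minus V
        (scal (c : C_AbsRing) (scal (rot p ^ j : C_AbsRing)%C (G' (RtoC s * rot p ^ j)%C)))
        (minus (G (RtoC s * rot p ^ S j)%C) (G (RtoC s * rot p ^ j)%C)))).
      + rewrite avg_minus, avg_scal, avg_minus.
        rewrite (avg_rotate p (fun j => G (RtoC s * rot p ^ j)%C))
          by now rewrite circle_period.
        fold X; vec V.
      + apply avg_ext; intros j; vec V.
    - apply avg_norm_le; intros j; rewrite norm_opp.
      set (z := (RtoC s * rot p ^ j)%C).
      assert (E : (RtoC s * rot p ^ S j)%C = (rot p * z)%C) by apply circle_rotate.
      rewrite E.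
      assert (Ez : (rot p * z - z)%C = (c * rot p ^ j)%C) by (unfold z, c; ring).
      assert (Em : Cmod (rot p * z - z) = Cmod c)
        by (rewrite Ez, Cmod_mult, Cmod_rot_pow; ring).
      rewrite <- Em.
      eapply norm_eq_le; [|apply (HG z (rot p * z)%C); apply HD; left].
      + rewrite Ez; vec V.
      + unfold z; apply Cmod_circle; lra.
      + rewrite <- E; apply Cmod_circle; lra. }
  (* The same expansion in the radial direction, with increments [h * rot p ^ j]: the linear term is
     [h X], the remainder costs [B h^2]. *)
  apply Rle_trans with (h * (B * (s * Cmod (rot p - 1))) + B * h ^ 2); [|lra].
  apply norm_eq_le with (plus (scal (RtoC h : C_AbsRing) X) (avg p (fun j =>
    minus (minus (G (RtoC (s + h) * rot p ^ j)%C) (G (RtoC s * rot p ^ j)%C))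
      (scal (RtoC h : C_AbsRing)
        (scal (rot p ^ j : C_AbsRing)%C (G' (RtoC s * rot p ^ j)%C)))))).
  - rewrite (avg_minus p (fun j => minus (G (RtoC (s + h) * rot p ^ j)%C)
      (G (RtoC s * rot p ^ j)%C))), avg_minus, avg_scal; fold X; unfold cavg; vec V.
  - apply norm_plus_le.
    + apply norm_scal_le; auto; rewrite Cmod_R, Rabs_pos_eq; lra.
    + apply avg_norm_le; intros j.
      set (z := (RtoC s * rot p ^ j)%C); set (w := (RtoC (s + h) * rot p ^ j)%C).
      assert (Ez : (w - z)%C = (RtoC h * rot p ^ j)%C)
        by (unfold z, w; rewrite RtoC_plus; ring).
      assert (Em : Cmod (w - z) = h) by (rewrite Ez; now apply Cmod_circle).
      rewrite <- Em at 2.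
      eapply norm_eq_le; [|apply (HG z w); apply HD].
      * rewrite Ez; vec V.
      * left; unfold z; apply Cmod_circle; lra.
      * right; unfold w; apply Cmod_circle; lra.
Qed.

(** The radii are joined by [p + 1] steps of length [(r2 - r1) / (p + 1)]. Each step errs by
    [O(1 / p^2)], so the total error is [O(1 / p)]. *)
Lemma cavg_annulus {V : NormedModule C_AbsRing} (r1 r2 : R) (G : C -> V) (e : R) :
  0 < r1 <= r2 -> smooth (annulus r1 r2) G -> 0 < e ->
  eventually (fun p => norm (minus (cavg p r2 G) (cavg p r1 G)) <= e).
Proof.
  intros Hr [G' [B [HB HG]]] He.
  set (c := B * (r2 - r1) * (r2 * (2 * PI) + (r2 - r1))).
  generalize (filter_and _ _ (eventually_small c e He) (eventually_ge 1)).
  apply filter_imp; intros p [Hc Hp]; apply Rle_trans with (2 := Hc).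
  set (L := INR (S p)); assert (HL : 0 < L) by apply INR_S_pos.
  set (h := (r2 - r1) / L).
  assert (Hh : 0 <= h) by (apply Rmult_le_pos; [lra | now apply Rlt_le, Rinv_0_lt_compat]).
  assert (HLh : L * h = r2 - r1) by (unfold h; field; lra).
  assert (Hstep : forall i, (i <= S p)%nat ->
    norm (minus (cavg p (r1 + INR i * h) G) (cavg p r1 G))
      <= INR i * (B * h * (r2 * Cmod (rot p - 1) + h))).
  { induction i as [|i IH]; intros Hi.
    - simpl INR; rewrite !Rmult_0_l, Rplus_0_r.
      rewrite norm_minus_diag; lra.
    - assert (Hi' : INR i * h <= (L - 1) * h).
      { apply Rmult_le_compat_r; auto; unfold L; rewrite S_INR.
        assert (INR i <= INR p) by (apply le_INR; lia); lra. }
      assert (Hi0 : 0 <= INR i * h) by (apply Rmult_le_pos; auto; apply pos_INR).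
      rewrite S_INR.
      replace (r1 + (INR i + 1) * h) with (r1 + INR i * h + h) by ring.
      set (X := B * h * (r2 * Cmod (rot p - 1) + h)) in *.
      replace ((INR i + 1) * X) with (X + INR i * X) by ring; unfold X at 1.
      eapply norm_eq_le; [|apply norm_plus_le; [|apply IH; lia]].
      2: { eapply Rle_trans.
           - apply (cavg_radial_step (annulus r1 r2) G G' B (r1 + INR i * h) h p);
               try lra; try lia.
             + intros z [E|E]; unfold annulus; rewrite E; lra.
             + intros z w Hz Hw; apply HG; auto.
           - apply Rmult_le_compat_l; [now apply Rmult_le_pos|].
             apply Rplus_le_compat_r, Rmult_le_compat_r; [apply Cmod_ge_0 | lra]. }
      vec V. }
  specialize (Hstep (S p) (le_n _)); fold L in Hstep.
  replace (r1 + L * h) with r2 in Hstep by lra.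
  apply Rle_trans with (1 := Hstep).
  replace (L * (B * h * (r2 * Cmod (rot p - 1) + h)))
    with (B * (L * h) * (r2 * Cmod (rot p - 1) + h)) by ring.
  rewrite HLh.
  replace (c / L) with (B * (r2 - r1) * (r2 * (2 * PI / L) + (r2 - r1) / L))
    by (unfold c; field; lra).
  apply Rmult_le_compat_l; [apply Rmult_le_pos; lra|].
  apply Rplus_le_compat; [|apply Rle_refl].
  apply Rmult_le_compat_l; [lra | apply rot_near_1].
Qed.

(** * Powers on the unit circle and the Poisson kernel *)

Lemma unit_pow_expansion (w : C) (i : nat) : Cmod w = 1 ->
  Cmod (w ^ i - 1) <= INR i * Cmod (w - 1) /\
  Cmod (w ^ i - 1 - RtoC (INR i) * (w - 1)) <= INR i ^ 2 / 2 * Cmod (w - 1) ^ 2.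
Proof.
  intros Hw; set (e := Cmod (w - 1)); assert (He : 0 <= e) by apply Cmod_ge_0.
  induction i as [|i [IH1 IH2]].
  - simpl INR; replace (w ^ 0 - 1)%C with (RtoC 0) by (simpl; ring).
    replace (0 - RtoC 0 * (w - 1))%C with (RtoC 0) by ring.
    rewrite Cmod_0; split; lra.
  - rewrite S_INR, Cpow_S; split.
    + replace (w * w ^ i - 1)%C with (w * (w ^ i - 1) + (w - 1))%C by ring.
      apply Rle_trans with (1 := Cmod_triangle _ _).
      rewrite Cmod_mult, Hw; fold e; lra.
    + replace (w * w ^ i - 1 - RtoC (INR i + 1) * (w - 1))%C
        with ((w ^ i - 1 - RtoC (INR i) * (w - 1)) + (w - 1) * (w ^ i - 1))%C
        by (rewrite RtoC_plus; ring).
      apply Rle_trans with (1 := Cmod_triangle _ _).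
      rewrite Cmod_mult; fold e.
      assert (e * Cmod (w ^ i - 1) <= e * (INR i * e)) by now apply Rmult_le_compat_l.
      assert (H2 := pow2_ge_0 e); simpl in *; nra.
Qed.

(** By the expansion, [|w^i - 1| >= t - t^2 / 2 >= t / 2] with [t = i |w - 1| <= 1]. *)
Lemma unit_pow_minus_1_ge (w : C) (i : nat) : Cmod w = 1 ->
  INR i * Cmod (w - 1) <= 1 -> INR i / 2 * Cmod (w - 1) <= Cmod (w ^ i - 1).
Proof.
  intros Hw Hi; destruct (unit_pow_expansion w i Hw) as [_ H].
  set (e := Cmod (w - 1)) in *; assert (He : 0 <= e) by apply Cmod_ge_0.
  assert (Ht := Cmod_triangle (w ^ i - 1) (- (w ^ i - 1 - RtoC (INR i) * (w - 1)))).
  replace (w ^ i - 1 + - (w ^ i - 1 - RtoC (INR i) * (w - 1)))%C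
    with (RtoC (INR i) * (w - 1))%C in Ht by ring.
  rewrite Cmod_opp, Cmod_mult, Cmod_R, Rabs_pos_eq in Ht by apply pos_INR.
  fold e in Ht.
  assert (H0 : 0 <= INR i * e) by (apply Rmult_le_pos; auto; apply pos_INR).
  assert ((INR i * e) * (INR i * e) <= 1 * (INR i * e)) by (apply Rmult_le_compat_r; lra).
  simpl in H; nra.
Qed.

Lemma Re_avg (p : nat) (g : nat -> C) :
  Re (avg (V := C_NormedModule) p g) = ravg p (fun j => Re (g j)).
Proof.
  assert (E : forall n, Re (sum_n (G := C_AbelianMonoid) g n) = sum_n (fun j => Re (g j)) n).
  { induction n as [|n IH]; [now rewrite !sum_O|].
    rewrite !sum_Sn, <- IH; reflexivity. }
  unfold avg, ravg; rewrite <- E.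
  set (s := sum_n (G := C_AbelianMonoid) g p).
  change (Re (RtoC (/ INR (S p)) * s)%C = / INR (S p) * Re s).
  unfold Cmult, RtoC, Re; cbn [fst snd]; ring.
Qed.

Lemma Re_poisson (z : C) : z <> RtoC 1 ->
  Re ((1 + z) / (1 - z))%C = (1 - Cmod z ^ 2) / Cmod (1 - z) ^ 2.
Proof.
  intros Hz; rewrite !Cmod2_alt.
  destruct z as [x y].
  assert (H : (1 - x) ^ 2 + y ^ 2 <> 0).
  { intros E; destruct (Rplus_sqr_eq_0 (1 - x) y) as [E1 E2].
    - rewrite <- E; unfold Rsqr; ring.
    - apply Hz; unfold RtoC; f_equal; lra. }
  unfold Cdiv, Cinv, Cmult, Cplus, Cminus, Copp, RtoC, Re, Im; cbn -[pow].
  field; intros E; apply H; rewrite <- E; ring.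
Qed.

(* The average is that of the Poisson kernel, up to the factor [1 - r ^ 2]. *)
Lemma poisson_average (r : R) : 1 / 2 <= r < 1 ->
  eventually (fun p =>
    ravg p (fun j => / Cmod (1 - RtoC r * rot p ^ j) ^ 2) <= 4 / (1 - r ^ 2)).
Proof.
  intros Hr; set (G := fun z : C => ((1 + z) / (1 - z))%C).
  assert (Hne : forall z, Cmod z <= r -> 1 - r <= Cmod (1 - z)).
  { intros z Hz; assert (Ht := Cmod_triangle (1 - z) z).
    replace (1 - z + z)%C with (RtoC 1) in Ht by ring; rewrite Cmod_1 in Ht; lra. }
  assert (HG : smooth (V := C_NormedModule) (annulus (1 / 2) r) G).
  { assert (Hid : Csmooth (annulus (1 / 2) r) (fun z => z)).
    { apply (Csmooth_id _ r); intros z [_ H]; exact H. }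
    apply (Csmooth_mult _ (fun z => 1 + z)%C (fun z => / (1 - z))%C).
    - apply Csmooth_plus; [apply Csmooth_const | exact Hid].
    - apply (Csmooth_inv _ (fun z => 1 - z)%C (1 - r)); [lra | |].
      + intros z [_ H]; now apply Hne.
      + apply (smooth_ext (V := C_NormedModule) _ (fun z => RtoC 1 + RtoC (-1) * z)%C).
        * intros z _; C_eq; ring.
        * apply Csmooth_plus; [apply Csmooth_const|].
          apply Csmooth_mult; [apply Csmooth_const | exact Hid]. }
  assert (Hr' : 0 < 1 / 2 <= r) by lra.
  (* Comparison with the circle of radius [1 / 2], with tolerance 1; there
     [|G z| <= (3 / 2) / (1 / 2) = 3], whence the constant [4 = 1 + 3]. *)
  generalize (cavg_annulus (1 / 2) r G 1 Hr' HG Rlt_0_1).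
  apply filter_imp; intros p Hp.
  assert (H3 : norm (cavg p (1 / 2) G) <= 3).
  { apply cavg_norm_le; [lra|]; intros z Hz.
    assert (H1 : 1 / 2 <= Cmod (1 - z)).
    { assert (Ht := Cmod_triangle (1 - z) z).
      replace (1 - z + z)%C with (RtoC 1) in Ht by ring; rewrite Cmod_1 in Ht; lra. }
    change (Cmod (G z) <= 3); unfold G.
    assert (H0 : (1 - z)%C <> RtoC 0) by (apply Cmod_gt_0; lra).
    rewrite Cmod_div by auto.
    assert (H2 := Cmod_triangle 1 z); rewrite Cmod_1 in H2.
    apply Rmult_le_reg_r with (Cmod (1 - z)); [lra|].
    unfold Rdiv; rewrite Rmult_assoc, Rinv_l by lra; lra. }
  assert (H4 : norm (cavg p r G) <= 4).
  { replace 4 with (1 + 3) by ring.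
    eapply norm_eq_le; [|apply norm_plus_le; [exact Hp | exact H3]].
    vec C_NormedModule. }
  assert (Hr2 : 0 < 1 - r ^ 2) by nra.
  apply Rmult_le_reg_l with (1 - r ^ 2); auto.
  replace ((1 - r ^ 2) * (4 / (1 - r ^ 2))) with 4 by (field; lra).
  rewrite <- ravg_mult.
  apply Rle_trans with (2 := H4).
  apply Rle_trans with (Re (cavg p r G));
    [|apply Rle_trans with (2 := re_le_Cmod _); apply Rle_abs].
  unfold cavg; rewrite (Re_avg p (fun j => G (RtoC r * rot p ^ j)%C)).
  apply ravg_le; intros j; unfold G.
  assert (Hm : Cmod (RtoC r * rot p ^ j) = r) by (apply Cmod_circle; lra).
  rewrite Re_poisson, Hm; [apply Rle_refl|].
  intros E; rewrite E, Cmod_1 in Hm; lra.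
Qed.

(** * Resolvents *)

Definition resolvent_bound {V : NormedModule C_AbsRing} (A : linear_operator V)
    (M : R) (Rs : C -> V -> V) (l : C) : Prop :=
  is_resolvent A l (Rs l) /\ forall x, norm (A (Rs l x)) <= M * norm x.

Lemma op_minus {V : NormedModule C_AbsRing} (A : linear_operator V) (x y : V) :
  dom A x -> dom A y -> A (minus x y) = minus (A x) (A y).
Proof.
  intros Hx Hy.
  assert (E : minus x y = plus x (scal (RtoC (-1) : C_AbsRing) y)) by vec V.
  rewrite E, op_plus, op_scal; auto using dom_scal; vec V.
Qed.

(** With [y = Ra x], the equation [(a - A) y = x] reads [(b - A) y = (b - a) y + x]; apply [Rb]. *)
Lemma resolvent_diff {V : NormedModule C_AbsRing} (A : linear_operator V)
    (a b : C) (Ra Rb : V -> V) (x : V) :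
  is_resolvent A a Ra -> is_resolvent A b Rb ->
  minus (Ra x) (Rb x) = scal (b - a : C_AbsRing)%C (Rb (Ra x)).
Proof.
  intros [_ [Ha _]] [[Hp Hs _] [_ Hb]].
  destruct (Ha x) as [Hd E].
  set (y := Ra x) in *.
  assert (E2 : y = plus (scal (b - a : C_AbsRing)%C (Rb y)) (Rb x)).
  { assert (E3 : Rb (plus (scal (b - a : C_AbsRing)%C y) x) = y).
    { transitivity (Rb (minus (scal (b : C_AbsRing) y) (A y))); [|exact (Hb y Hd)].
      apply f_equal; rewrite <- E; vec V. }
    rewrite <- E3 at 1; rewrite Hp; apply (f_equal (fun v => plus v (Rb x))), Hs. }
  rewrite E2 at 1; vec V.
Qed.

Lemma op_resolvent_diff {V : NormedModule C_AbsRing} (A : linear_operator V)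
    (a b : C) (Ra Rb : V -> V) (x : V) :
  is_resolvent A a Ra -> is_resolvent A b Rb ->
  minus (A (Ra x)) (A (Rb x)) = scal (b - a : C_AbsRing)%C (A (Rb (Ra x))).
Proof.
  intros Ha Hb.
  assert (E := resolvent_diff A a b Ra Rb x Ha Hb).
  destruct Ha as [_ [Ha _]], Hb as [_ [Hb _]].
  destruct (Ha x) as [Da _], (Hb x) as [Db _], (Hb (Ra x)) as [Dc _].
  now rewrite <- op_minus, E, op_scal.
Qed.

(** From [l R_l x = x + A R_l x]: a bound on [A R_l] is also one on [l R_l]. *)
Lemma resolvent_norm {V : NormedModule C_AbsRing} (A : linear_operator V)
    (M c : R) (Rs : C -> V -> V) (l : C) (x : V) :
  resolvent_bound A M Rs l -> 0 < c <= Cmod l ->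
  norm (Rs l x) <= (1 + M) * norm x / c.
Proof.
  intros [[_ [H _]] HM] Hc.
  destruct (H x) as [_ E]; specialize (HM x).
  assert (H1 : norm (scal (l : C_AbsRing) (Rs l x)) <= (1 + M) * norm x).
  { replace ((1 + M) * norm x) with (norm x + M * norm x) by ring.
    eapply norm_eq_le; [|apply norm_plus_le; [apply Rle_refl | exact HM]].
    rewrite <- E at 2; vec V. }
  assert (H0 := Rle_trans _ _ _ (norm_ge_0 _) H1).
  apply norm_scal_cancel in H1; [|apply Cmod_gt_0; lra].
  apply Rle_trans with (1 := H1).
  apply Rmult_le_compat_l; auto; apply Rinv_le_contravar; lra.
Qed.

(** The derivative of [A R_l] is [- A R_l R_l]; applying the resolvent identity twice, the remainder
    is exactly [(w - z)^2 A R_z R_w R_z]. Each resolvent not preceded by [A] costs [(1 + M) / c]. *)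
Lemma smooth_resolvent {V : NormedModule C_AbsRing} (A : linear_operator V)
    (M c : R) (Rs : C -> V -> V) (x : V) : 0 <= M -> 0 < c ->
  smooth (fun l => resolvent_bound A M Rs l /\ c <= Cmod l) (fun l => A (Rs l x)).
Proof.
  intros HM Hc.
  exists (fun l => opp (A (Rs l (Rs l x)))).
  set (N := (1 + M) / c).
  assert (HN : 0 <= N) by (apply Rmult_le_pos; [lra | now apply Rlt_le, Rinv_0_lt_compat]).
  assert (Hx := norm_ge_0 x).
  exists (M * (norm x + N * norm x + N * (N * norm x))).
  assert (HNx := Rmult_le_pos _ _ HN Hx); assert (HNNx := Rmult_le_pos _ _ HN HNx).
  assert (P1 := Rmult_le_pos _ _ HM Hx); assert (P2 := Rmult_le_pos _ _ HM HNx);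
    assert (P3 := Rmult_le_pos _ _ HM HNNx).
  split; [lra|]; intros z w [Hz Hzc] [Hw Hwc].
  assert (Bd : forall l y b, resolvent_bound A M Rs l -> c <= Cmod l -> norm y <= b ->
    norm (A (Rs l y)) <= M * b /\ norm (Rs l y) <= N * b).
  { intros l y b Hl Hlc Hy; split.
    - apply Rle_trans with (1 := proj2 Hl y); now apply Rmult_le_compat_l.
    - apply Rle_trans with ((1 + M) * norm y / c).
      + apply (resolvent_norm A); auto.
      + replace ((1 + M) * norm y / c) with (N * norm y) by (unfold N, Rdiv; ring).
        now apply Rmult_le_compat_l. }
  assert (Hd := Cmod_ge_0 (w - z)).
  destruct (Bd z x _ Hz Hzc (Rle_refl _)) as [z1 z2].
  destruct (Bd z (Rs z x) _ Hz Hzc z2) as [zz1 _].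
  destruct (Bd w (Rs z x) _ Hw Hwc z2) as [wz1 wz2].
  destruct (Bd z (Rs w (Rs z x)) _ Hz Hzc wz2) as [zwz _].
  assert (E1 := op_resolvent_diff A z w (Rs z) (Rs w) x (proj1 Hz) (proj1 Hw)).
  assert (E2 := op_resolvent_diff A w z (Rs w) (Rs z) (Rs z x) (proj1 Hw) (proj1 Hz)).
  assert (E3 : minus (A (Rs w x)) (A (Rs z x))
    = scal (- (w - z) : C_AbsRing)%C (A (Rs w (Rs z x)))).
  { transitivity (opp (minus (A (Rs z x)) (A (Rs w x)))); [vec V|].
    rewrite E1; vec V. }
  repeat split.
  - lra.
  - rewrite norm_opp; lra.
  - rewrite E3, Rmult_comm; apply norm_scal_le; [rewrite Cmod_opp; lra | lra].
  - rewrite E3, Rmult_comm.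
    eapply norm_eq_le; [|apply norm_scal_le with (c := ((w - z) ^ 2)%C)].
    2: rewrite Cmod_pow; lra.
    2: apply Rle_trans with (1 := zwz); lra.
    assert (E4 : A (Rs w (Rs z x)) = plus (A (Rs z (Rs z x)))
      (scal (z - w : C_AbsRing)%C (A (Rs z (Rs w (Rs z x)))))) by (rewrite <- E2; vec V).
    rewrite E4; vec V.
Qed.

(** The second difference equals [(2 b - a - c) A R_b R_a + (b - c) (a - c) A R_b R_a R_c]. Since
    [R_b] always stands next to [A], only [|a|] and [|c|] enter the denominators. *)
Lemma op_resolvent_second_difference {V : NormedModule C_AbsRing} (A : linear_operator V)
    (M : R) (Rs : C -> V -> V) (a b c : C) (x : V) (p q : R) : 0 <= M ->
  resolvent_bound A M Rs a -> resolvent_bound A M Rs b -> resolvent_bound A M Rs c ->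
  0 < p <= Cmod a -> 0 < q <= Cmod c ->
  norm (plus (minus (A (Rs a x)) (scal (RtoC 2 : C_AbsRing) (A (Rs b x)))) (A (Rs c x)))
  <= M * (1 + M) ^ 2 * norm x *
     (Cmod (2 * b - a - c) / p + Cmod (b - c) * Cmod (a - c) / (p * q)).
Proof.
  intros HM Ha Hb Hc Hp Hq.
  assert (E1 := op_resolvent_diff A a b _ _ x (proj1 Ha) (proj1 Hb)).
  assert (E2 := op_resolvent_diff A c b _ _ x (proj1 Hc) (proj1 Hb)).
  assert (E3 := resolvent_diff A c a _ _ x (proj1 Hc) (proj1 Ha)).
  assert (E4 : Rs c x = plus (Rs a x) (scal (a - c : C_AbsRing)%C (Rs a (Rs c x))))
    by (rewrite <- E3; vec V).
  assert (E5 : A (Rs b (Rs c x)) = plus (A (Rs b (Rs a x)))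
      (scal (a - c : C_AbsRing)%C (A (Rs b (Rs a (Rs c x)))))).
  { rewrite E4 at 1.
    destruct Hb as [[[Lp Ls _] [Hb _]] _].
    rewrite Lp, Ls, op_plus, op_scal; auto; try apply Hb.
    apply dom_scal, Hb. }
  assert (Hx := norm_ge_0 x).
  assert (N1 := resolvent_norm A M p Rs a x Ha Hp).
  assert (N2 := resolvent_norm A M q Rs c x Hc Hq).
  assert (N3 := resolvent_norm A M p Rs a (Rs c x) Ha Hp).
  assert (B1 := proj2 Hb (Rs a x)).
  assert (B2 := proj2 Hb (Rs a (Rs c x))).
  assert (Hip : 0 < / p) by (apply Rinv_0_lt_compat; lra).
  assert (Hiq : 0 < / q) by (apply Rinv_0_lt_compat; lra).
  set (d2 := Cmod (2 * b - a - c)); set (d1 := Cmod (b - c)); set (d3 := Cmod (a - c)).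
  assert (D2 : 0 <= d2) by apply Cmod_ge_0.
  assert (D1 : 0 <= d1 * d3) by (apply Rmult_le_pos; apply Cmod_ge_0).
  apply Rle_trans with (d2 * (M * ((1 + M) * norm x / p))
     + (d1 * d3) * (M * ((1 + M) * ((1 + M) * norm x / q) / p))).
  - eapply norm_eq_le.
    2: { apply norm_plus_le.
         - apply norm_scal_le; [apply Rle_refl|].
           apply Rle_trans with (1 := B1); now apply Rmult_le_compat_l.
         - apply norm_scal_le with (c := ((b - c) * (a - c))%C);
             [rewrite Cmod_mult; apply Rle_refl|].
           apply Rle_trans with (1 := B2); apply Rmult_le_compat_l; auto.
           apply Rle_trans with (1 := N3).
           unfold Rdiv; apply Rmult_le_compat_r; [lra|].
           apply Rmult_le_compat_l; [lra | exact N2]. }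
    transitivity (plus (minus (A (Rs a x)) (A (Rs b x))) (minus (A (Rs c x)) (A (Rs b x))));
      [vec V|].
    rewrite E1, E2, E5; vec V.
  - assert (T : M * (1 + M) * norm x * (d2 * / p) <= M * (1 + M) ^ 2 * norm x * (d2 * / p)).
    { apply Rmult_le_compat_r; [apply Rmult_le_pos; lra|].
      apply Rmult_le_compat_r; auto; apply Rmult_le_compat_l; auto; nra. }
    replace (d1 * d3 * (M * ((1 + M) * ((1 + M) * norm x / q) / p)))
      with (M * (1 + M) ^ 2 * norm x * (d1 * d3 / (p * q))) by (field; lra).
    unfold Rdiv in *; lra.
Qed.

(** Expansion about the middle point [w z]: the increments [(w - 1) w z] and [- (w - 1) z] add up to
    [(w - 1)^2 z]. The two remainders and this term give [L = 3 B]. *)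
Lemma bdf_symbol_constants (k : nat) : (1 <= k <= 6)%nat ->
  exists c L : R, 0 < c /\ 0 <= L /\
    (forall z, Cmod z <= 1 -> c * Cmod (1 - z) <= Cmod (bdf_symbol k z)) /\
    (forall z w, Cmod z <= 1 -> Cmod w <= 1 ->
      Cmod (bdf_symbol k w - bdf_symbol k z) <= L * Cmod (w - z)) /\
    (forall z w, Cmod z <= 1 -> Cmod w = 1 ->
      Cmod (2 * bdf_symbol k (w * z) - bdf_symbol k (w * (w * z)) - bdf_symbol k z)
        <= L * Cmod (w - 1) ^ 2).
Proof.
  intros Hk; destruct (bdf_zero_stable k Hk) as [c [Hc Hlow]].
  destruct (Csmooth_bdf k) as [d [B [HB Hd]]].
  exists c, (3 * B); repeat split; auto; try lra.
  - intros z w Hz Hw; destruct (Hd z w Hz Hw) as [_ [_ [H _]]].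
    apply Rle_trans with (1 := H); assert (H' := Cmod_ge_0 (w - z)); nra.
  - intros z w Hz Hw; set (e := Cmod (w - 1)); set (s := bdf_symbol k).
    assert (He : 0 <= e) by apply Cmod_ge_0; assert (Hz0 := Cmod_ge_0 z).
    assert (H1 : Cmod (w * z) <= 1) by (rewrite Cmod_mult, Hw; lra).
    assert (H2 : Cmod (w * (w * z)) <= 1) by (rewrite Cmod_mult, Hw; lra).
    destruct (Hd (w * z)%C (w * (w * z))%C H1 H2) as [_ [D0 [_ D1]]].
    destruct (Hd (w * z)%C z H1 Hz) as [_ [_ [_ D2]]].
    replace (w * (w * z) - w * z)%C with ((w - 1) * (w * z))%C in D1 by ring.
    replace (z - w * z)%C with (- ((w - 1) * z))%C in D2 by ring.
    assert (I : forall t, Cmod t <= 1 -> Cmod ((w - 1) * t) ^ 2 <= e ^ 2).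
    { intros t Ht; apply pow_incr; split; [apply Cmod_ge_0|].
      rewrite Cmod_mult; fold e; assert (Ht0 := Cmod_ge_0 t); nra. }
    assert (I1 := I _ H1); assert (I2 := I _ Hz).
    rewrite Cmod_opp in D2.
    fold s in D1, D2.
    set (X := (s (w * (w * z)) - s (w * z) - (w - 1) * (w * z) * d (w * z))%C) in D1.
    set (Y := (s z - s (w * z) - - ((w - 1) * z) * d (w * z))%C) in D2.
    replace (2 * s (w * z) - s (w * (w * z)) - s z)%C
      with (- (X + Y) - (w - 1) ^ 2 * (z * d (w * z)))%C by (unfold X, Y; ring).
    unfold Cminus at 1; apply Rle_trans with (1 := Cmod_triangle _ _).
    rewrite !Cmod_opp.
    assert (H3 := Cmod_triangle X Y).
    assert (H4 : Cmod ((w - 1) ^ 2 * (z * d (w * z)%C)) <= e ^ 2 * B).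
    { rewrite Cmod_mult, Cmod_pow; fold e.
      apply Rmult_le_compat_l; [apply pow2_ge_0|].
      rewrite Cmod_mult; assert (H5 := Cmod_ge_0 (d (w * z)%C)).
      apply Rle_trans with (1 * B); [apply Rmult_le_compat; auto | lra]. }
    assert (B * Cmod ((w - 1) * (w * z)) ^ 2 <= B * e ^ 2) by now apply Rmult_le_compat_l.
    assert (B * Cmod ((w - 1) * z) ^ 2 <= B * e ^ 2) by now apply Rmult_le_compat_l.
    lra.
Qed.

(** * Kernel of the discrete convolution *)

Definition scaled_symbol (k : nat) (tau : R) (z : C) : C :=
  (RtoC (/ tau) * bdf_symbol k z)%C.

Section CircleLinearity.

Context {V : NormedModule C_AbsRing}.
Implicit Types G H : C -> V.

Lemma cavg_plus (p : nat) (r : R) G H :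
  cavg p r (fun z => plus (G z) (H z)) = plus (cavg p r G) (cavg p r H).
Proof.
  exact (avg_plus p (fun j => G (RtoC r * rot p ^ j)%C)
    (fun j => H (RtoC r * rot p ^ j)%C)).
Qed.

Lemma cavg_minus (p : nat) (r : R) G H :
  cavg p r (fun z => minus (G z) (H z)) = minus (cavg p r G) (cavg p r H).
Proof.
  exact (avg_minus p (fun j => G (RtoC r * rot p ^ j)%C)
    (fun j => H (RtoC r * rot p ^ j)%C)).
Qed.

Lemma cavg_scal (p : nat) (r : R) (c : C) G :
  cavg p r (fun z => scal (c : C_AbsRing) (G z)) = scal (c : C_AbsRing) (cavg p r G).
Proof. exact (avg_scal p c (fun j => G (RtoC r * rot p ^ j)%C)). Qed.

(* A rotation by [w = rot p] acts on a Fourier coefficient as multiplication by [w ^ i]. *)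
Lemma cavg_second_difference (p i : nat) (r : R) (H : C -> V) : 0 < r ->
  cavg p r (fun z => scal (/ z ^ i : C_AbsRing)%C
    (plus (minus (H (rot p * (rot p * z))%C) (scal (RtoC 2 : C_AbsRing) (H (rot p * z)%C)))
       (H z)))
  = scal ((rot p ^ i - 1) ^ 2 : C_AbsRing)%C
      (cavg p r (fun z => scal (/ z ^ i : C_AbsRing)%C (H z))).
Proof.
  intros Hr; set (w := rot p); set (g := fun z => scal (/ z ^ i : C_AbsRing)%C (H z)).
  assert (Hw : w <> RtoC 0) by (apply Cmod_gt_0; unfold w; rewrite Cmod_rot; lra).
  transitivity (cavg p r (fun z => @plus V (@minus V
    (scal ((w ^ i) ^ 2 : C_AbsRing)%C (g (w * (w * z))%C))
    (scal (2 * w ^ i : C_AbsRing)%C (g (w * z)%C))) (g z))).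
  - apply cavg_ext; [lra|]; intros z Hz; unfold g.
    assert (Hz0 : z <> RtoC 0) by (apply Cmod_gt_0; lra).
    rewrite !Cpow_mult_l.
    assert (Hwi := Cpow_nz w i Hw); assert (Hzi := Cpow_nz z i Hz0).
    vec_eq V; try ring; simpl; field; auto.
  - rewrite (cavg_plus p r (fun z => @minus V
      (scal ((w ^ i) ^ 2 : C_AbsRing)%C (g (w * (w * z))%C))
      (scal (2 * w ^ i : C_AbsRing)%C (g (w * z)%C))) g).
    rewrite (cavg_minus p r (fun z => scal ((w ^ i) ^ 2 : C_AbsRing)%C (g (w * (w * z))%C))
      (fun z => scal (2 * w ^ i : C_AbsRing)%C (g (w * z)%C))).
    rewrite !cavg_scal.
    rewrite (cavg_rotate p r (fun z => g (w * z)%C) : cavg p r (fun z => g (w * (w * z))%C) = _).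
    rewrite (cavg_rotate p r g : cavg p r (fun z => g (w * z)%C) = _).
    vec V.
Qed.

End CircleLinearity.

(** Numerators and denominators of the resolvent estimate carry the same powers of [1 / tau], which
    therefore cancel; this is where the final constant becomes independent of the stepsize. *)
Lemma kernel_second_difference {V : NormedModule C_AbsRing} (A : linear_operator V)
    (M c L tau : R) (Rs : C -> V -> V) (k : nat) (w z : C) (x : V) :
  0 <= M -> 0 < c -> 0 <= L -> 0 < tau ->
  (forall z, Cmod z <= 1 -> c * Cmod (1 - z) <= Cmod (bdf_symbol k z)) ->
  (forall z w, Cmod z <= 1 -> Cmod w <= 1 ->
    Cmod (bdf_symbol k w - bdf_symbol k z) <= L * Cmod (w - z)) ->
  (forall z w, Cmod z <= 1 -> Cmod w = 1 ->
    Cmod (2 * bdf_symbol k (w * z) - bdf_symbol k (w * (w * z)) - bdf_symbol k z)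
      <= L * Cmod (w - 1) ^ 2) ->
  (forall z, Cmod z < 1 -> resolvent_bound A M Rs (scaled_symbol k tau z)) ->
  Cmod w = 1 -> Cmod z < 1 ->
  norm (plus (minus (A (Rs (scaled_symbol k tau (w * (w * z))) x))
     (scal (RtoC 2 : C_AbsRing) (A (Rs (scaled_symbol k tau (w * z)) x))))
     (A (Rs (scaled_symbol k tau z) x)))
  <= M * (1 + M) ^ 2 * (2 * L / c + L ^ 2 / c ^ 2) * norm x * Cmod (w - 1) ^ 2 *
     (/ Cmod (1 - w * (w * z)) ^ 2 + / Cmod (1 - z) ^ 2).
Proof.
  intros HM Hc HL Ht Hlow Hlip Hsec HR Hw Hz.
  set (e := Cmod (w - 1)); assert (He : 0 <= e) by apply Cmod_ge_0.
  set (u := Cmod (1 - w * (w * z))); set (v := Cmod (1 - z)).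
  assert (Hz0 := Cmod_ge_0 z).
  assert (Hz1 : Cmod (w * z) = Cmod z) by (rewrite Cmod_mult, Hw; ring).
  assert (Hz2 : Cmod (w * (w * z)) = Cmod z) by (rewrite Cmod_mult, Hw, Hz1; ring).
  assert (Hpos : forall y, Cmod y < 1 -> 0 < Cmod (1 - y)).
  { intros y Hy; assert (T := Cmod_triangle (1 - y) y).
    replace (1 - y + y)%C with (RtoC 1) in T by ring; rewrite Cmod_1 in T; lra. }
  assert (Hu : 0 < u) by (apply Hpos; lra); assert (Hv : 0 < v) by (apply Hpos; lra).
  assert (Hu2 : u <= 2).
  { unfold u, Cminus; apply Rle_trans with (1 := Cmod_triangle _ _).
    rewrite Cmod_opp, Cmod_1; lra. }
  assert (Hit : 0 < / tau) by now apply Rinv_0_lt_compat.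
  assert (Hscale : forall y, Cmod (RtoC (/ tau) * y) = / tau * Cmod y).
  { intros y; rewrite Cmod_mult, Cmod_R, Rabs_pos_eq; lra. }
  assert (Hmu : forall y, Cmod y < 1 ->
    0 < / tau * (c * Cmod (1 - y)) <= Cmod (scaled_symbol k tau y)).
  { intros y Hy; unfold scaled_symbol; rewrite Hscale; split.
    - apply Rmult_lt_0_compat; auto; apply Rmult_lt_0_compat; auto.
    - apply Rmult_le_compat_l; [lra|]; apply Hlow; lra. }
  assert (Hz1' : Cmod (w * z) < 1) by lra; assert (Hz2' : Cmod (w * (w * z)) < 1) by lra.
  eapply Rle_trans.
  { apply (op_resolvent_second_difference A M Rs) with
      (p := / tau * (c * u)) (q := / tau * (c * v)); auto; now apply Hmu. }
  assert (Hx := norm_ge_0 x).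
  assert (HMx : 0 <= M * (1 + M) ^ 2 * norm x).
  { apply Rmult_le_pos; auto; apply Rmult_le_pos; auto; apply pow2_ge_0. }
  replace (M * (1 + M) ^ 2 * (2 * L / c + L ^ 2 / c ^ 2) * norm x * e ^ 2 * (/ u ^ 2 + / v ^ 2))
    with (M * (1 + M) ^ 2 * norm x *
      ((2 * L / c + L ^ 2 / c ^ 2) * e ^ 2 * (/ u ^ 2 + / v ^ 2))) by ring.
  apply Rmult_le_compat_l; auto.
  unfold scaled_symbol; set (s := bdf_symbol k) in *; set (t := RtoC (/ tau)).
  replace (2 * (t * s (w * z)%C) - t * s (w * (w * z))%C - t * s z)%C
    with (t * (2 * s (w * z)%C - s (w * (w * z))%C - s z))%C by ring.
  replace (t * s (w * z)%C - t * s z)%C with (t * (s (w * z)%C - s z))%C by ring.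
  replace (t * s (w * (w * z))%C - t * s z)%C with (t * (s (w * (w * z))%C - s z))%C by ring.
  unfold t; rewrite !Hscale.
  assert (B1 := Hsec z w (Rlt_le _ _ Hz) Hw); fold s e in B1.
  assert (B2 := Hlip z (w * z)%C (Rlt_le _ _ Hz) (Rlt_le _ _ Hz1')).
  assert (B3 := Hlip z (w * (w * z))%C (Rlt_le _ _ Hz) (Rlt_le _ _ Hz2')).
  fold s in B2, B3.
  set (d2 := Cmod (2 * s (w * z)%C - s (w * (w * z))%C - s z)) in *.
  set (d1 := Cmod (s (w * z)%C - s z)) in *.
  set (d3 := Cmod (s (w * (w * z))%C - s z)) in *.
  assert (C1 : d1 <= L * e).
  { apply Rle_trans with (1 := B2); apply Rmult_le_compat_l; auto.
    replace (w * z - z)%C with ((w - 1) * z)%C by ring.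
    rewrite Cmod_mult; fold e; nra. }
  assert (C3 : d3 <= 2 * (L * e)).
  { apply Rle_trans with (1 := B3).
    replace (2 * (L * e)) with (L * (2 * e)) by ring; apply Rmult_le_compat_l; auto.
    replace (w * (w * z) - z)%C with ((w - 1) * (w * z) + (w - 1) * z)%C by ring.
    apply Rle_trans with (1 := Cmod_triangle _ _); rewrite !Cmod_mult, Hw; fold e; nra. }
  assert (D1 : 0 <= d1) by apply Cmod_ge_0.
  assert (D3 : 0 <= d3) by apply Cmod_ge_0.
  set (a := / u); set (b := / v).
  (* [u <= 2] gives [a <= 2 a^2], so the single inverse power is absorbed into the squares; the
     mixed product is split by [2 a b <= a^2 + b^2]. *)
  assert (Ha : / 2 <= a) by (apply Rinv_le_contravar; lra).
  assert (Hb : 0 < b) by now apply Rinv_0_lt_compat.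
  replace (/ tau * d2 / (/ tau * (c * u))) with (d2 * (/ c * a))
    by (unfold a; field; lra).
  replace (/ tau * d1 * (/ tau * d3) / (/ tau * (c * u) * (/ tau * (c * v))))
    with ((d1 * d3) * (/ c ^ 2 * (a * b))) by (unfold a, b; field; lra).
  rewrite <- (pow_inv u 2), <- (pow_inv v 2); fold a b.
  assert (Hic : 0 < / c) by now apply Rinv_0_lt_compat.
  assert (Hic2 : 0 < / c ^ 2) by now apply Rinv_0_lt_compat, pow_lt.
  apply Rle_trans with (L * e ^ 2 * (/ c * a) + (L * e) * (2 * (L * e)) * (/ c ^ 2 * (a * b))).
  - apply Rplus_le_compat.
    + apply Rmult_le_compat_r; auto; apply Rmult_le_pos; lra.
    + apply Rmult_le_compat_r; [apply Rmult_le_pos; [lra | apply Rmult_le_pos; lra]|].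
      now apply Rmult_le_compat.
  - assert (Hab : 2 * (a * b) <= a ^ 2 + b ^ 2)
      by (assert (H := pow2_ge_0 (a - b)); simpl in *; lra).
    assert (Haa : a <= 2 * (a ^ 2 + b ^ 2)).
    { assert (H := pow2_ge_0 b); simpl in *; nra. }
    assert (P1 : 0 <= L * / c * e ^ 2)
      by (apply Rmult_le_pos; [apply Rmult_le_pos; lra | apply pow2_ge_0]).
    assert (P2 : 0 <= L ^ 2 * / c ^ 2 * e ^ 2)
      by (apply Rmult_le_pos; [apply Rmult_le_pos; [apply pow2_ge_0 | lra] | apply pow2_ge_0]).
    apply Rle_trans with (L * / c * e ^ 2 * a + L ^ 2 * / c ^ 2 * e ^ 2 * (2 * (a * b))).
    + apply Req_le; ring.
    + apply Rle_trans with (L * / c * e ^ 2 * (2 * (a ^ 2 + b ^ 2))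
        + L ^ 2 * / c ^ 2 * e ^ 2 * (a ^ 2 + b ^ 2)).
      * apply Rplus_le_compat; now apply Rmult_le_compat_l.
      * apply Req_le; unfold Rdiv; ring.
Qed.

Lemma bernoulli_ge (x : R) (n : nat) : -1 <= x -> 1 + INR n * x <= (1 + x) ^ n.
Proof.
  intros Hx; induction n as [|n IH]; [simpl; lra|].
  rewrite S_INR; simpl pow.
  assert (H := pos_INR n); assert (H2 := Rle_0_sqr x); unfold Rsqr in H2.
  assert ((1 + x) * (1 + INR n * x) <= (1 + x) * (1 + x) ^ n)
    by (apply Rmult_le_compat_l; lra).
  assert (0 <= INR n * (x * x)) by now apply Rmult_le_pos.
  lra.
Qed.

(* On the circle of radius [r = 1 - 1 / (2 i)] both [r ^ (- i)] and [(1 - r ^ 2) ^ (- 1) / i]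
   are bounded, and the second differences gain a factor [i ^ 2]. *)
Lemma kernel_decay {V : NormedModule C_AbsRing} (A : linear_operator V)
    (M : R) (Rs : C -> V -> V) (k : nat) : (1 <= k <= 6)%nat -> 0 <= M ->
  exists K : R, 0 <= K /\ forall tau : R, 0 < tau ->
    (forall z, Cmod z < 1 -> resolvent_bound A M Rs (scaled_symbol k tau z)) ->
    forall (i : nat) (x : V), (1 <= i)%nat ->
    eventually (fun p =>
      norm (cavg p (1 - / (2 * INR i))
        (fun z => scal (/ z ^ i : C_AbsRing)%C (A (Rs (scaled_symbol k tau z) x))))
      <= K / INR i * norm x).
Proof.
  intros Hk HM; destruct (bdf_symbol_constants k Hk) as [c [L [Hc [HL [Hlow [Hlip Hsec]]]]]].
  set (K2 := M * (1 + M) ^ 2 * (2 * L / c + L ^ 2 / c ^ 2)).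
  assert (HK2 : 0 <= K2).
  { assert (Hic : 0 < / c) by now apply Rinv_0_lt_compat.
    assert (Hic2 : 0 < / c ^ 2) by now apply Rinv_0_lt_compat, pow_lt.
    apply Rmult_le_pos; [apply Rmult_le_pos; [auto | apply pow2_ge_0]|].
    apply Rplus_le_le_0_compat; apply Rmult_le_pos; try lra; apply pow2_ge_0. }
  (* [128 = 2 * 2 * 8 * 4]: the factor [r^-i <= 2]; two Poisson averages, at [z] and at [w w z],
     each at most [8 i]; and [|w^i - 1|^-2 <= 4 / (i |w - 1|)^2]. *)
  exists (128 * K2); split; [lra|]; intros tau Ht HR i x Hi.
  assert (Hn : 1 <= INR i) by (apply (le_INR 1); lia).
  set (n := INR i) in *; set (r := 1 - / (2 * n)).
  assert (Hin : 0 < / (2 * n) <= 1 / 2).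
  { split; [apply Rinv_0_lt_compat; lra|].
    replace (1 / 2) with (/ 2) by lra; apply Rinv_le_contravar; lra. }
  assert (Hr : 1 / 2 <= r < 1) by (unfold r; lra).
  assert (Hri : / 2 <= r ^ i).
  { assert (H : 1 + n * (- / (2 * n)) <= r ^ i).
    { replace r with (1 + - / (2 * n)) by (unfold r; ring).
      apply bernoulli_ge; lra. }
    replace (n * - / (2 * n)) with (- / 2) in H by (field; lra); lra. }
  assert (Hr2 : / (2 * n) <= 1 - r ^ 2) by (unfold r in *; nra).
  assert (Hen : 0 < / n) by (apply Rinv_0_lt_compat; lra).
  (* [|w - 1| <= 1 / i] is the condition of the lower bound on [|w^i - 1|], and [p >= 1] makes [w]
     different from 1. *)
  generalize (filter_and _ _ (poisson_average r Hr)
    (filter_and _ _ (eventually_rot_near (/ n) Hen) (eventually_ge 1))).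
  apply filter_imp; intros p [Hpo [Hnear Hp]].
  set (w := rot p) in *; set (e := Cmod (w - 1)) in *.
  assert (He : 0 < e) by now apply rot_neq_1.
  assert (Hw : Cmod w = 1) by apply Cmod_rot.
  assert (Hx := norm_ge_0 x).
  set (H := fun z => A (Rs (scaled_symbol k tau z) x)).
  assert (Hlb : n / 2 * e <= Cmod (w ^ i - 1)).
  { apply unit_pow_minus_1_ge; auto; fold e n.
    apply Rle_trans with (n * / n); [apply Rmult_le_compat_l; lra|].
    rewrite Rinv_r; lra. }
  set (y := Cmod (w ^ i - 1)) in *.
  assert (Hne : 0 < n / 2 * e) by (apply Rmult_lt_0_compat; lra).
  set (T := cavg p r (fun z => scal (/ z ^ i : C_AbsRing)%C (H z))).
  change (norm T <= 128 * K2 / n * norm x).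
  set (Q := 4 / (1 - r ^ 2)) in *.
  assert (HS : norm (scal ((w ^ i - 1) ^ 2 : C_AbsRing)%C T)
    <= 2 * (K2 * norm x * e ^ 2) * (2 * Q)).
  { eapply norm_eq_le; [symmetry; apply (cavg_second_difference p i r H); lra|]; fold w.
    unfold cavg; eapply Rle_trans; [apply avg_norm_ravg|].
    set (kappa := 2 * (K2 * norm x * e ^ 2)).
    fold w; set (g := fun j => / Cmod (1 - RtoC r * w ^ j) ^ 2).
    assert (Hk0 : 0 <= kappa).
    { unfold kappa; assert (H2 := pow2_ge_0 e).
      assert (H3 := Rmult_le_pos _ _ (Rmult_le_pos _ _ HK2 Hx) H2); lra. }
    apply Rle_trans with (ravg p (fun j => kappa * (g (S (S j)) + g j))).
    - apply ravg_le; intros j.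
      set (z := (RtoC r * w ^ j)%C).
      assert (Hz : Cmod z = r) by (apply Cmod_circle; lra).
      unfold kappa; rewrite Rmult_assoc; apply norm_scal_le.
      + assert (Hz0 : z <> RtoC 0) by (apply Cmod_gt_0; lra).
        rewrite Cmod_inv by now apply Cpow_nz.
        rewrite Cmod_pow, Hz; replace 2 with (/ / 2) by field.
        apply Rinv_le_contravar; lra.
      + unfold g; replace (RtoC r * w ^ S (S j))%C with (w * (w * z))%C
          by (unfold z; rewrite !Cpow_S; ring).
        fold z.
        eapply Rle_trans; [apply (kernel_second_difference A M c L tau Rs k w z x); auto; lra|].
        fold e K2; apply Req_le; ring.
    - rewrite ravg_mult; apply Rmult_le_compat_l; auto.
      (* [g (S (S j))] is the kernel at [w w z]; two rotations turn its average into that of [g]. *)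
      rewrite (ravg_plus p (fun j => g (S (S j))) g).
      rewrite (ravg_rotate p (fun j => g (S j))).
      2: { unfold g, w; rewrite (Cpow_S _ (S p)), rot_period, Cmult_1_r, Cpow_1_r; reflexivity. }
      rewrite (ravg_rotate p g) by (unfold g, w; now rewrite circle_period).
      assert (ravg p g <= Q) by exact Hpo; lra. }
  apply norm_scal_cancel in HS.
  2: { apply Cpow_nz, Cmod_gt_0; fold y; lra. }
  rewrite Cmod_pow in HS; fold y in HS.
  apply Rle_trans with (1 := HS).
  assert (HQ : Q <= 8 * n).
  { unfold Q; apply Rle_trans with (4 / / (2 * n)).
    - apply Rmult_le_compat_l; [lra|]; apply Rinv_le_contravar; lra.
    - apply Req_le; field; lra. }
  assert (Hee : 0 <= K2 * norm x * e ^ 2)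
    by (apply Rmult_le_pos; [now apply Rmult_le_pos | apply pow2_ge_0]).
  assert (Hy2 : (n / 2 * e) ^ 2 <= y ^ 2) by (apply pow_incr; lra).
  apply Rle_trans with (2 * (K2 * norm x * e ^ 2) * (2 * (8 * n)) / (n / 2 * e) ^ 2).
  - unfold Rdiv at 1 3; apply Rmult_le_compat.
    + apply Rmult_le_pos; [lra|]; assert (0 < Q); [|lra].
      unfold Q; apply Rdiv_lt_0_compat; lra.
    + apply Rlt_le, Rinv_0_lt_compat, pow_lt; lra.
    + apply Rmult_le_compat_l; lra.
    + apply Rinv_le_contravar; [apply pow_lt; lra | exact Hy2].
  - apply Req_le; field; lra.
Qed.

(** On [|z| <= r] the scaled symbol keeps the distance [c (1 - r) / tau] from 0. The smoothness
    constant depends on [tau] and [r], but it only decides how large [p] must be and never enters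
    the final bound. *)
Lemma smooth_kernel {V : NormedModule C_AbsRing} (A : linear_operator V)
    (M tau r : R) (Rs : C -> V -> V) (k : nat) (x : V) :
  (1 <= k <= 6)%nat -> 0 <= M -> 0 < tau -> r < 1 ->
  (forall z, Cmod z < 1 -> resolvent_bound A M Rs (scaled_symbol k tau z)) ->
  smooth (fun z => Cmod z <= r) (fun z => A (Rs (scaled_symbol k tau z) x)).
Proof.
  intros Hk HM Ht Hr HR.
  destruct (bdf_symbol_constants k Hk) as [c [L [Hc [_ [Hlow _]]]]].
  assert (Hit : 0 < / tau) by now apply Rinv_0_lt_compat.
  assert (Hd : 0 < / tau * (c * (1 - r)))
    by (apply Rmult_lt_0_compat; auto; apply Rmult_lt_0_compat; lra).
  apply (smooth_comp _ _ (scaled_symbol k tau) _) with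
    (2 := Csmooth_mult _ _ _ (Csmooth_const _ _)
            (smooth_sub (V := C_NormedModule) (fun z => Cmod z <= 1) _ _
               (fun z H => Rle_trans _ _ _ H (Rlt_le _ _ Hr)) (Csmooth_bdf k)))
    (3 := smooth_resolvent A M _ Rs x HM Hd).
  intros z Hz; split; [apply HR; lra|].
  unfold scaled_symbol; rewrite Cmod_mult, Cmod_R, Rabs_pos_eq by lra.
  apply Rmult_le_compat_l; [lra|].
  apply Rle_trans with (c * Cmod (1 - z)); [|apply Hlow; lra].
  apply Rmult_le_compat_l; [lra|].
  assert (T := Cmod_triangle (1 - z) z).
  replace (1 - z + z)%C with (RtoC 1) in T by ring; rewrite Cmod_1 in T; lra.
Qed.

(** The decay estimate lives on a circle that varies with the coefficient; moving all averages to
    the common radius [1 / 2] costs [e]. The constant [K] is fixed before [tau], [n], [l] and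
    [x]. *)
Lemma kernel_coefficient {V : NormedModule C_AbsRing} (A : linear_operator V)
    (M : R) (Rs : C -> V -> V) (k : nat) : (1 <= k <= 6)%nat -> 0 <= M ->
  exists K : R, 0 <= K /\ forall tau : R, 0 < tau ->
    (forall z, Cmod z < 1 -> resolvent_bound A M Rs (scaled_symbol k tau z)) ->
    forall (n l : nat) (x : V) (e : R), 0 < e ->
    eventually (fun p =>
      norm (cavg p (1 / 2) (fun z => scal (z ^ l * / z ^ n : C_AbsRing)%C
        (A (Rs (scaled_symbol k tau z) x))))
      <= (if (l <=? n)%nat then K / INR (S (n - l)) * norm x else 0) + e).
Proof.
  intros Hk HM; destruct (kernel_decay A M Rs k Hk HM) as [K0 [HK0 Hdecay]].
  (* [1 / i <= 2 / (i + 1)] for [i >= 1] accounts for [2 K0], and [M] covers [i = 0]. *)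
  exists (2 * K0 + M); split; [lra|]; intros tau Ht HR n l x e He.
  set (H := fun z => A (Rs (scaled_symbol k tau z) x)).
  assert (Hx := norm_ge_0 x).
  assert (Hbound : forall z, Cmod z < 1 -> norm (H z) <= M * norm x)
    by (intros z Hz; apply (HR z Hz)).
  assert (HMx := Rmult_le_pos _ _ HM Hx).
  destruct (Nat.leb_spec l n) as [Hl | Hl].
  - set (i := (n - l)%nat).
    assert (Hext : forall p r, 0 < r ->
      cavg p r (fun z => scal (z ^ l * / z ^ n : C_AbsRing)%C (H z))
      = cavg p r (fun z => scal (/ z ^ i : C_AbsRing)%C (H z))).
    { intros p r Hr; apply cavg_ext; [lra|]; intros z Hz.
      assert (Hz0 : z <> RtoC 0) by (apply Cmod_gt_0; lra).
      replace n with (l + i)%nat by (unfold i; lia); rewrite Cpow_add_r.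
      assert (P1 := Cpow_nz z l Hz0); assert (P2 := Cpow_nz z i Hz0).
      vec_eq V; field; auto. }
    destruct (Nat.eq_dec i 0) as [Hi | Hi].
    + apply filter_forall; intros p; rewrite Hext, Hi by lra.
      apply Rle_trans with (M * norm x).
      * apply cavg_norm_le; [lra|]; intros z Hz.
        rewrite <- (Rmult_1_l (M * norm x)); apply norm_scal_le.
        -- replace (/ z ^ 0)%C with (RtoC 1) by (simpl; field); rewrite Cmod_1; lra.
        -- apply Hbound; lra.
      * assert (0 <= K0 * norm x) by now apply Rmult_le_pos.
        simpl INR; lra.
    + assert (Hn : 1 <= INR i) by (apply (le_INR 1); lia).
      set (r := 1 - / (2 * INR i)).
      assert (Hin : 0 < / (2 * INR i) <= 1 / 2).
      { split; [apply Rinv_0_lt_compat; lra|].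
        replace (1 / 2) with (/ 2) by lra; apply Rinv_le_contravar; lra. }
      assert (Hr : 0 < 1 / 2 <= r) by (unfold r; lra).
      assert (Hsm : smooth (annulus (1 / 2) r)
          (fun z => scal (/ z ^ i : C_AbsRing)%C (H z))).
      { apply smooth_scal.
        - apply (Csmooth_inv _ (fun z => z ^ i)%C ((1 / 2) ^ i)); [apply pow_lt; lra | |].
          + intros z [Hz _]; rewrite Cmod_pow; apply pow_incr; lra.
          + apply Csmooth_pow, (Csmooth_id _ r); intros z [_ Hz]; exact Hz.
        - apply (smooth_sub (fun z => Cmod z <= r)); [intros z [_ Hz]; exact Hz|].
          apply (smooth_kernel A M); auto; unfold r; lra. }
      assert (Hi1 : (1 <= i)%nat) by lia.
      generalize (filter_and _ _ (cavg_annulus (1 / 2) r _ e Hr Hsm He)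
        (Hdecay tau Ht HR i x Hi1)).
      apply filter_imp; intros p [H1 H2]; rewrite Hext by lra.
      fold r in H2.
      apply Rle_trans with (K0 / INR i * norm x + e).
      * eapply norm_eq_le; [|apply norm_minus_le; [exact H2 | exact H1]].
        unfold H; vec V.
      * apply Rplus_le_compat_r, Rmult_le_compat_r; auto.
        rewrite S_INR.
        apply Rmult_le_reg_r with (INR i * (INR i + 1)); [apply Rmult_lt_0_compat; lra|].
        replace (K0 / INR i * (INR i * (INR i + 1))) with (K0 * (INR i + 1)) by (field; lra).
        replace ((2 * K0 + M) / (INR i + 1) * (INR i * (INR i + 1)))
          with ((2 * K0 + M) * INR i) by (field; lra).
        nra.
  (* For [l > n] the power of [z] is positive and there is no pole: on a circle of radius [r] with
     [r M |x| <= e / 2] the average is at most [e / 2], and the passage to radius [1 / 2] costs the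
     other half. *)
  - set (i := (l - n)%nat).
    assert (Hext : forall p r, 0 < r ->
      cavg p r (fun z => scal (z ^ l * / z ^ n : C_AbsRing)%C (H z))
      = cavg p r (fun z => scal (z ^ i : C_AbsRing)%C (H z))).
    { intros p r Hr; apply cavg_ext; [lra|]; intros z Hz.
      assert (Hz0 : z <> RtoC 0) by (apply Cmod_gt_0; lra).
      replace l with (n + i)%nat by (unfold i; lia); rewrite Cpow_add_r.
      assert (P1 := Cpow_nz z n Hz0).
      vec_eq V; field; auto. }
    set (d := M * norm x + 1).
    set (r := Rmin (1 / 2) (e / (2 * d))).
    assert (Hd : 0 < d) by (unfold d; lra).
    assert (Hr0 : 0 < r).
    { apply Rmin_glb_lt; [lra|]; apply Rdiv_lt_0_compat; lra. }
    assert (Hr1 : r <= 1 / 2) by apply Rmin_l.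
    assert (Hr2 : r * (M * norm x) <= e / 2).
    { apply Rle_trans with (e / (2 * d) * d).
      - apply Rmult_le_compat; try lra; [apply Rmin_r | unfold d; lra].
      - apply Req_le; field; lra. }
    assert (Hr : 0 < r <= 1 / 2) by lra.
    assert (He2 : 0 < e / 2) by lra.
    assert (Hsm : smooth (annulus r (1 / 2)) (fun z => scal (z ^ i : C_AbsRing)%C (H z))).
    { apply smooth_scal.
      - apply Csmooth_pow, (Csmooth_id _ (1 / 2)); intros z [_ Hz]; exact Hz.
      - apply (smooth_sub (fun z => Cmod z <= 1 / 2)); [intros z [_ Hz]; exact Hz|].
        apply (smooth_kernel A M); auto; lra. }
    generalize (cavg_annulus r (1 / 2) _ (e / 2) Hr Hsm He2).
    apply filter_imp; intros p Hp; rewrite Hext by lra.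
    assert (H2 : norm (cavg p r (fun z => scal (z ^ i : C_AbsRing)%C (H z))) <= e / 2).
    { apply Rle_trans with (2 := Hr2); apply cavg_norm_le; [lra|]; intros z Hz.
      apply norm_scal_le; [|apply Hbound; lra].
      rewrite Cmod_pow, Hz; replace i with (S (i - 1)) by (unfold i; lia); simpl.
      assert (Hp1 : r ^ (i - 1) <= 1 ^ (i - 1)) by (apply pow_incr; lra).
      rewrite pow1 in Hp1; nra. }
    replace (0 + e) with (e / 2 + e / 2) by field.
    eapply norm_eq_le; [|apply norm_plus_le; [exact Hp | exact H2]].
    vec V.
Qed.

(** * Generating functions *)

Lemma op_zero {V : NormedModule C_AbsRing} (A : linear_operator V) : A zero = zero.
Proof.
  transitivity (A (scal (RtoC 0 : C_AbsRing) zero)); [apply f_equal; vec V|].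
  rewrite op_scal by apply dom_zero; vec V.
Qed.

Lemma op_sum {V : NormedModule C_AbsRing} (A : linear_operator V)
    (c : nat -> C) (v : nat -> V) (n : nat) :
  (forall i, dom A (v i)) ->
  dom A (sum_n (fun i => scal (c i : C_AbsRing) (v i)) n) /\
  A (sum_n (fun i => scal (c i : C_AbsRing) (v i)) n)
    = sum_n (fun i => scal (c i : C_AbsRing) (A (v i))) n.
Proof.
  intros Hv; induction n as [|n [IH1 IH2]].
  - rewrite !sum_O; split; [apply dom_scal | apply op_scal]; auto.
  - rewrite !sum_Sn; split.
    + apply dom_plus; auto; now apply dom_scal.
    + rewrite <- IH2, <- op_scal by auto; apply op_plus; auto; now apply dom_scal.
Qed.

Lemma linear_sum {V : NormedModule C_AbsRing} (l : V -> V)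
    (c : nat -> C) (v : nat -> V) (n : nat) : is_linear l ->
  l (sum_n (fun i => scal (c i : C_AbsRing) (v i)) n)
    = sum_n (fun i => scal (c i : C_AbsRing) (l (v i))) n.
Proof.
  intros [Hp Hs _]; induction n as [|n IH].
  - rewrite !sum_O; apply Hs.
  - rewrite !sum_Sn, <- IH, <- Hs; apply Hp.
Qed.

Lemma sum_scal_l {V : NormedModule C_AbsRing} (c : C) (v : nat -> V) (n : nat) :
  sum_n (fun i => scal (c : C_AbsRing) (v i)) n = scal (c : C_AbsRing) (sum_n v n).
Proof. exact (sum_n_m_scal_l (c : C_AbsRing) v 0 n). Qed.

Lemma sum_scal_r {V : NormedModule C_AbsRing} (c : nat -> C) (x : V) (n : nat) :
  sum_n (fun i => scal (c i : C_AbsRing) x) n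
    = scal (sum_n (G := C_AbelianMonoid) c n : C_AbsRing) x.
Proof.
  induction n as [|n IH]; [now rewrite !sum_O|].
  rewrite !sum_Sn, IH.
  change (@plus C_AbelianMonoid) with Cplus; vec V.
Qed.

Lemma sum_zero_tail {G : AbelianMonoid} (v : nat -> G) (n m : nat) :
  (n <= m)%nat -> (forall i, (n < i)%nat -> v i = zero) -> sum_n v m = sum_n v n.
Proof.
  intros Hm Hv; induction Hm as [|m Hm IH]; [reflexivity|].
  rewrite sum_Sn, IH, Hv by lia; apply plus_zero_r.
Qed.

Lemma sum_zero_terms {G : AbelianMonoid} (v : nat -> G) (n : nat) :
  (forall i, (i <= n)%nat -> v i = zero) -> sum_n v n = zero.
Proof.
  intros Hv; induction n as [|n IH]; [rewrite sum_O; auto|].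
  rewrite sum_Sn, IH, Hv by auto; apply plus_zero_r.
Qed.

Lemma generating_shift {V : NormedModule C_AbsRing} (z : C) (v : nat -> V) (j n : nat) :
  v 0%nat = zero ->
  sum_n (fun l => scal (z ^ l : C_AbsRing)%C (v (l - j)%nat)) (n + j)
    = scal (z ^ j : C_AbsRing)%C (sum_n (fun i => scal (z ^ i : C_AbsRing)%C (v i)) n).
Proof.
  intros H0; induction n as [|n IH].
  - rewrite sum_O, H0; transitivity (@zero V); [|vec V].
    apply sum_zero_terms; intros i Hi; replace (i - j)%nat with 0%nat by lia; rewrite H0; vec V.
  - replace (S n + j)%nat with (S (n + j)) by lia.
    rewrite sum_Sn, IH, sum_Sn.
    replace (S (n + j) - j)%nat with (S n) by lia.
    replace (S (n + j)) with (j + S n)%nat by lia; rewrite Cpow_add_r; vec V.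
Qed.

(* The convolution [sum_j delta_j v_(l-j)] is written with truncated subtraction, which is
   harmless since [v 0 = 0]. *)
Lemma generating_bdf {V : NormedModule C_AbsRing} (z : C) (v : nat -> V) (k n : nat) :
  v 0%nat = zero -> (forall i, (n < i)%nat -> v i = zero) ->
  sum_n (fun l => scal (z ^ l : C_AbsRing)%C
      (sum_n (fun j => scal (RtoC (bdf_delta k j) : C_AbsRing) (v (l - j)%nat)) k)) (n + k)
    = scal (bdf_symbol k z : C_AbsRing)
        (sum_n (fun i => scal (z ^ i : C_AbsRing)%C (v i)) n).
Proof.
  intros H0 Hv; set (P := sum_n (fun i => scal (z ^ i : C_AbsRing)%C (v i)) n).
  transitivity (sum_n (fun l => sum_n (fun j => scal (z ^ l : C_AbsRing)%C
      (scal (RtoC (bdf_delta k j) : C_AbsRing) (v (l - j)%nat))) k) (n + k)).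
  { apply sum_n_ext; intros l; symmetry; apply sum_scal_l. }
  rewrite (sum_n_switch (fun l j => scal (z ^ l : C_AbsRing)%C
      (scal (RtoC (bdf_delta k j) : C_AbsRing) (v (l - j)%nat)))).
  transitivity (sum_n (fun j => scal (RtoC (bdf_delta k j) * z ^ j : C_AbsRing)%C P) k).
  - apply sum_n_ext_loc; intros j Hj.
    transitivity (scal (RtoC (bdf_delta k j) : C_AbsRing)
      (sum_n (fun l => scal (z ^ l : C_AbsRing)%C (v (l - j)%nat)) ((n + k - j) + j))).
    + replace (n + k - j + j)%nat with (n + k)%nat by lia.
      transitivity (sum_n (fun l => scal (RtoC (bdf_delta k j) : C_AbsRing)
        (scal (z ^ l : C_AbsRing)%C (v (l - j)%nat))) (n + k)).
      * apply sum_n_ext; intros l; vec V.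
      * exact (sum_scal_l _ _ _).
    + rewrite generating_shift by auto.
      assert (E : sum_n (fun i => scal (z ^ i : C_AbsRing)%C (v i)) (n + k - j) = P).
      { apply (sum_zero_tail (fun i => scal (z ^ i : C_AbsRing)%C (v i))); [lia|].
        intros i Hi; rewrite Hv by auto; vec V. }
      rewrite E; vec V.
  - rewrite sum_scal_r, bdf_delta_symbol; reflexivity.
Qed.

(** Rotation invariance multiplies the average by [w^i / w^n]; unless this factor is 1, the average
    is 0. *)
Lemma cavg_monomial {V : NormedModule C_AbsRing} (p n i : nat) (r : R) (x : V) : 0 < r ->
  (i <> n -> (rot p ^ i)%C <> (rot p ^ n)%C) ->
  cavg p r (fun z => scal (z ^ i * / z ^ n : C_AbsRing)%C x)
    = if (i =? n)%nat then x else zero.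
Proof.
  intros Hr Hi; set (w := rot p) in *.
  assert (Hw : w <> RtoC 0) by (apply Cmod_gt_0; unfold w; rewrite Cmod_rot; lra).
  assert (Hwn := Cpow_nz w n Hw).
  set (T := cavg p r _).
  destruct (Nat.eqb_spec i n) as [E | E].
  - subst i; unfold T.
    transitivity (cavg p r (fun _ => x)).
    + apply cavg_ext; [lra|]; intros z Hz.
      assert (Hz0 : z <> RtoC 0) by (apply Cmod_gt_0; lra).
      assert (Hzn := Cpow_nz z n Hz0); vec_eq V; field; auto.
    + unfold cavg, avg.
      transitivity (scal (RtoC (/ INR (S p)) : C_AbsRing)
        (sum_n (fun _ => scal (RtoC 1 : C_AbsRing) x) p)).
      * apply f_equal, sum_n_ext; intros _; vec V.
      * rewrite sum_scal_r.
        assert (S1 : sum_n (G := C_AbelianMonoid) (fun _ => RtoC 1) p = RtoC (INR (S p))).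
        { clear; induction p as [|p IH]; [now rewrite sum_O|].
          rewrite sum_Sn, IH, (S_INR (S p)), RtoC_plus; reflexivity. }
        rewrite S1, RtoC_inv by (apply Rgt_not_eq, INR_S_pos).
        vec_eq V; field; intros E; injection E; apply Rgt_not_eq, INR_S_pos.
  - assert (E1 : T = scal (w ^ i * / w ^ n : C_AbsRing)%C T).
    { unfold T at 1; rewrite <- cavg_rotate; fold w.
      unfold T; rewrite <- cavg_scal; apply cavg_ext; [lra|]; intros z Hz.
      assert (Hz0 : z <> RtoC 0) by (apply Cmod_gt_0; lra).
      assert (Hzn := Cpow_nz z n Hz0); rewrite !Cpow_mult_l; vec_eq V; field; auto. }
    assert (Hq : (w ^ n - w ^ i)%C <> RtoC 0).
    { intros E2; apply (Hi E).
      replace (w ^ i)%C with (w ^ n - (w ^ n - w ^ i))%C by ring; rewrite E2; ring. }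
    transitivity (scal (w ^ n / (w ^ n - w ^ i) : C_AbsRing)%C
      (minus T (scal (w ^ i * / w ^ n : C_AbsRing)%C T))).
    + vec_eq V; field; auto.
    + rewrite <- E1; vec V.
Qed.

Lemma eventually_forall_le (Q : nat -> nat -> Prop) (n : nat) :
  (forall l, eventually (Q l)) -> eventually (fun p => forall l, (l <= n)%nat -> Q l p).
Proof.
  intros H; induction n as [|n IH].
  - generalize (H 0%nat); apply filter_imp; intros p Hp l Hl.
    now replace l with 0%nat by lia.
  - generalize (filter_and _ _ IH (H (S n))); apply filter_imp; intros p [H1 H2] l Hl.
    destruct (Nat.eq_dec l (S n)) as [E | E]; [now subst l | apply H1; lia].
Qed.

(** For [|w - 1| <= 1 / (n + 1)] the lower bound on [|w^(n - i) - 1|] is positive, which avoids any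
    discussion of the order of [rot p]. *)
Lemma eventually_rot_pow_neq (n : nat) :
  eventually (fun p => forall i, (i < n)%nat -> (rot p ^ i)%C <> (rot p ^ n)%C).
Proof.
  assert (Hn := INR_S_pos n).
  generalize (filter_and _ _ (eventually_rot_near _ (Rinv_0_lt_compat _ Hn)) (eventually_ge 1)).
  apply filter_imp; intros p [Hnear Hp] i Hi E.
  assert (He := rot_neq_1 p Hp); set (w := rot p) in *; set (e := Cmod (w - 1)) in *.
  assert (Hw : Cmod w = 1) by apply Cmod_rot.
  assert (Hw0 : w <> RtoC 0) by (apply Cmod_gt_0; lra).
  assert (E1 : (w ^ (n - i))%C = RtoC 1).
  { replace n with (i + (n - i))%nat in E by lia; rewrite Cpow_add_r in E.
    assert (Hwi := Cpow_nz w i Hw0).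
    replace (w ^ (n - i))%C with (/ w ^ i * (w ^ i * w ^ (n - i)))%C by (field; auto).
    rewrite <- E; field; auto. }
  assert (H1 : 1 <= INR (n - i)) by (apply (le_INR 1); lia).
  assert (H2 : INR (n - i) / 2 * e <= Cmod (w ^ (n - i) - 1)).
  { apply unit_pow_minus_1_ge; auto; fold e.
    apply Rle_trans with (INR (S n) * / INR (S n)).
    - apply Rmult_le_compat; try lra; apply le_INR; lia.
    - rewrite Rinv_r; lra. }
  rewrite E1 in H2; replace (1 - 1)%C with (RtoC 0) in H2 by ring.
  rewrite Cmod_0 in H2.
  assert (0 < INR (n - i) / 2 * e) by (apply Rmult_lt_0_compat; lra); lra.
Qed.

(** Entries of the lower triangular Toeplitz matrix that dominates the discrete convolution up to a
    constant. *)
Definition harmonic_weight (n l : nat) : R :=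
  if (l <=? n)%nat then / INR (S (n - l)) else 0.

Lemma harmonic_weight_nonneg (n l : nat) : 0 <= harmonic_weight n l.
Proof.
  unfold harmonic_weight; destruct (l <=? n)%nat; [|lra].
  apply Rlt_le, Rinv_0_lt_compat, INR_S_pos.
Qed.

(** Summing the scheme against [z^l] gives [(mu - A) P = sum z^l g_l]; apply the resolvent, then
    [A]. The range extends to [n + k] because the differences of [v] reach [k] indices beyond its
    last term. *)
Lemma generating_identity {V : NormedModule C_AbsRing} (A : linear_operator V)
    (mu : C) (Rm : V -> V) (g v : nat -> V) (z : C) (k n : nat) (t : R) :
  is_resolvent A mu Rm -> mu = (RtoC t * bdf_symbol k z)%C ->
  v 0%nat = zero -> (forall i, (n < i)%nat -> v i = zero) -> (forall i, dom A (v i)) ->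
  (forall l, g l = minus (scal (RtoC t : C_AbsRing)
     (sum_n (fun j => scal (RtoC (bdf_delta k j) : C_AbsRing) (v (l - j)%nat)) k)) (A (v l))) ->
  sum_n (fun i => scal (z ^ i : C_AbsRing)%C (A (v i))) n
    = sum_n (fun l => scal (z ^ l : C_AbsRing)%C (A (Rm (g l)))) (n + k).
Proof.
  intros [Hlin [HR HR2]] Hmu H0 Hv Hdom Hg.
  set (c := fun l => sum_n (fun j => scal (RtoC (bdf_delta k j) : C_AbsRing) (v (l - j)%nat)) k)
    in Hg.
  set (P := sum_n (fun i => scal (z ^ i : C_AbsRing)%C (v i)) n).
  destruct (op_sum A (fun i => z ^ i)%C v n Hdom) as [HP EP].
  assert (E1 : sum_n (fun l => scal (z ^ l : C_AbsRing)%C (g l)) (n + k)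
    = minus (scal (mu : C_AbsRing) P) (A P)).
  { transitivity (sum_n (fun l => plus
      (scal (RtoC t : C_AbsRing) (scal (z ^ l : C_AbsRing)%C (c l)))
      (scal (RtoC (-1) : C_AbsRing) (scal (z ^ l : C_AbsRing)%C (A (v l))))) (n + k)).
    - apply sum_n_ext; intros l; rewrite Hg; fold (c l); vec V.
    - rewrite sum_n_plus.
      transitivity (plus
        (scal (RtoC t : C_AbsRing) (sum_n (fun l => scal (z ^ l : C_AbsRing)%C (c l)) (n + k)))
        (scal (RtoC (-1) : C_AbsRing)
           (sum_n (fun l => scal (z ^ l : C_AbsRing)%C (A (v l))) (n + k)))).
      + apply (f_equal2 plus); exact (sum_scal_l _ _ _).
      + assert (E2 : sum_n (fun l => scal (z ^ l : C_AbsRing)%C (A (v l))) (n + k) = A P).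
        { transitivity (sum_n (fun l => scal (z ^ l : C_AbsRing)%C (A (v l))) n);
            [|symmetry; exact EP].
          apply sum_zero_tail; [lia|]; intros i Hi.
          rewrite Hv, op_zero by auto; vec V. }
        rewrite E2, Hmu.
        transitivity (plus (scal (RtoC t : C_AbsRing) (scal (bdf_symbol k z : C_AbsRing) P))
          (scal (RtoC (-1) : C_AbsRing) (A P))); [|vec V].
        apply (f_equal (fun y => plus (scal (RtoC t : C_AbsRing) y)
          (scal (RtoC (-1) : C_AbsRing) (A P)))).
        exact (generating_bdf z v k n H0 Hv). }
  rewrite <- EP; fold P.
  assert (E3 : P = sum_n (fun l => scal (z ^ l : C_AbsRing)%C (Rm (g l))) (n + k)).
  { transitivity (Rm (minus (scal (mu : C_AbsRing) P) (A P))).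
    - symmetry; exact (HR2 P HP).
    - rewrite <- E1; exact (linear_sum Rm _ g (n + k) Hlin). }
  rewrite E3.
  apply (op_sum A (fun l => z ^ l)%C (fun l => Rm (g l))).
  intros l; apply HR.
Qed.

Lemma bdf_pointwise_bound {V : NormedModule C_AbsRing} (A : linear_operator V)
    (M K tau : R) (Rs : C -> V -> V) (k N : nat) (f u : nat -> V) :
  (1 <= k)%nat -> 0 <= K -> 0 < tau ->
  (forall z, Cmod z < 1 -> resolvent_bound A M Rs (scaled_symbol k tau z)) ->
  (forall (n l : nat) (x : V) (e : R), 0 < e ->
    eventually (fun p =>
      norm (cavg p (1 / 2) (fun z => scal (z ^ l * / z ^ n : C_AbsRing)%C
        (A (Rs (scaled_symbol k tau z) x))))
      <= (if (l <=? n)%nat then K / INR (S (n - l)) * norm x else 0) + e)) ->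
  bdf_solution A k (S N) tau f u ->
  forall n, (n <= N)%nat ->
  norm (A (u (S n))) <= K * sum_n (fun l => harmonic_weight n l * norm (f (S l))) N.
Proof.
  intros Hk HK Ht HR Hker [Hu0 Hu] n Hn.
  assert (Hpos : 0 <= K * sum_n (fun l => harmonic_weight n l * norm (f (S l))) N).
  { apply Rmult_le_pos; auto.
    rewrite <- (sum_n_m_const_zero (G := R_AbelianMonoid) 0 N : _ = 0).
    apply sum_n_m_le; intros l; apply Rmult_le_pos;
      [apply harmonic_weight_nonneg | apply norm_ge_0]. }
  destruct (Nat.lt_ge_cases (S n) k) as [Hnk | Hnk].
  { rewrite Hu0, op_zero by auto.
    apply Rle_trans with (2 := Hpos); apply Req_le; exact norm_zero. }
  set (v := fun i => if (i <=? S n)%nat then u i else zero).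
  set (g := fun l => minus (scal (RtoC (/ tau) : C_AbsRing)
     (sum_n (fun j => scal (RtoC (bdf_delta k j) : C_AbsRing) (v (l - j)%nat)) k)) (A (v l))).
  assert (Hvu : forall i, (i <= S n)%nat -> v i = u i)
    by (intros i Hi; unfold v; apply Nat.leb_le in Hi; now rewrite Hi).
  assert (Hvz : forall i, (S n < i)%nat -> v i = zero)
    by (intros i Hi; unfold v; apply Nat.leb_gt in Hi; now rewrite Hi).
  assert (Hv0 : forall i, (i < k)%nat -> v i = zero)
    by (intros i Hi; rewrite Hvu by lia; auto).
  assert (Hdom : forall i, dom A (v i)).
  { intros i; unfold v; destruct (Nat.leb_spec i (S n)); [|apply dom_zero].
    destruct (Nat.lt_ge_cases i k); [rewrite Hu0 by auto; apply dom_zero|].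
    apply Hu; lia. }
  assert (Hg0 : forall l, (l < k)%nat -> g l = zero).
  { intros l Hl; unfold g; rewrite (Hv0 l) by auto; rewrite op_zero.
    transitivity (scal (RtoC (/ tau) : C_AbsRing) (@zero V)); [|vec V].
    transitivity (minus (scal (RtoC (/ tau) : C_AbsRing) (@zero V)) zero); [|vec V].
    apply (f_equal (fun y : V => minus (scal (RtoC (/ tau) : C_AbsRing) y) zero)).
    apply sum_zero_terms; intros j _; rewrite Hv0 by lia; vec V. }
  assert (Hgn : forall l, (l < k)%nat -> norm (g l) = 0)
    by (intros l Hl; rewrite Hg0 by auto; exact norm_zero).
  assert (Hgf : forall l, (k <= l <= S n)%nat -> g l = f l).
  { intros l Hl; unfold g.
    assert (E : sum_n (fun j => scal (RtoC (bdf_delta k j) : C_AbsRing) (v (l - j)%nat)) k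
      = sum_n (fun j => scal (RtoC (bdf_delta k j) : C_AbsRing) (u (l - j)%nat)) k).
    { apply sum_n_ext; intros j; rewrite Hvu by lia; reflexivity. }
    rewrite E, Hvu by lia.
    assert (Hl' : (k <= l <= S N)%nat) by lia.
    destruct (Hu l Hl') as [_ E2].
    transitivity (minus (plus (A (u l)) (f l)) (A (u l))); [|vec V].
    apply (f_equal (fun y : V => minus y (A (u l)))); exact E2. }
  set (b := fun l => if (l <=? S n)%nat then K / INR (S (S n - l)) * norm (g l) else 0).
  assert (Hmain : forall e, 0 < e -> norm (A (u (S n))) <= sum_n b (S n + k) + e).
  (* The tolerance is shared among the [S n + k + 1] terms; one sufficiently large [p] then serves
     all of them and also separates the monomials up to degree [S n]. Only [e] remains to be sent to
     0. *)
  { intros e He; set (e' := e / INR (S (S n + k))).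
    assert (HL := INR_S_pos (S n + k)).
    assert (He' : 0 < e') by now apply Rdiv_lt_0_compat.
    destruct (filter_ex _ (filter_and _ _
      (eventually_forall_le _ (S n + k) (fun l => Hker (S n) l (g l) e' He'))
      (eventually_rot_pow_neq (S n)))) as [p [Hp Hrot]].
    assert (Hr : 0 < 1 / 2) by lra.
    assert (E : A (u (S n)) = sum_n (fun l => cavg p (1 / 2)
      (fun z => scal (z ^ l * / z ^ S n : C_AbsRing)%C
        (A (Rs (scaled_symbol k tau z) (g l))))) (S n + k)).
    { transitivity (sum_n (fun i => cavg p (1 / 2)
        (fun z => scal (z ^ i * / z ^ S n : C_AbsRing)%C (A (v i)))) (S n)).
      - rewrite sum_Sn, sum_zero_terms.
        + rewrite cavg_monomial, Nat.eqb_refl, Hvu by (auto; contradiction); vec V.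
        + intros i Hi; rewrite cavg_monomial; [|lra|].
          * replace (i =? S n)%nat with false; [reflexivity|].
            symmetry; apply Nat.eqb_neq; lia.
          * intros _; apply Hrot; lia.
      - transitivity (cavg p (1 / 2) (fun z => scal (/ z ^ S n : C_AbsRing)%C
          (sum_n (fun i => scal (z ^ i : C_AbsRing)%C (A (v i))) (S n)))).
        + unfold cavg; rewrite <- (avg_sum p (S n) (fun i j =>
            scal ((RtoC (1 / 2) * rot p ^ j) ^ i * / (RtoC (1 / 2) * rot p ^ j) ^ S n : C_AbsRing)%C
              (A (v i)))).
          apply avg_ext; intros j; set (z := (RtoC (1 / 2) * rot p ^ j)%C).
          transitivity (sum_n (fun i => scal (/ z ^ S n : C_AbsRing)%C
            (scal (z ^ i : C_AbsRing)%C (A (v i)))) (S n)); [|exact (sum_scal_l _ _ _)].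
          apply sum_n_ext; intros i; vec V.
        + transitivity (cavg p (1 / 2) (fun z => scal (/ z ^ S n : C_AbsRing)%C
            (sum_n (fun l => scal (z ^ l : C_AbsRing)%C
               (A (Rs (scaled_symbol k tau z) (g l)))) (S n + k)))).
          * apply cavg_ext; [lra|]; intros z Hz; apply f_equal.
            assert (Hz1 : Cmod z < 1) by lra.
            apply (generating_identity A (scaled_symbol k tau z) _ g v z k (S n) (/ tau));
              auto; apply (HR z Hz1).
          * unfold cavg; rewrite <- (avg_sum p (S n + k) (fun l j =>
              scal ((RtoC (1 / 2) * rot p ^ j) ^ l * / (RtoC (1 / 2) * rot p ^ j) ^ S n
                : C_AbsRing)%C
              (A (Rs (scaled_symbol k tau (RtoC (1 / 2) * rot p ^ j)) (g l))))).
            apply avg_ext; intros j; set (z := (RtoC (1 / 2) * rot p ^ j)%C).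
            transitivity (sum_n (fun l => scal (/ z ^ S n : C_AbsRing)%C
              (scal (z ^ l : C_AbsRing)%C (A (Rs (scaled_symbol k tau z) (g l))))) (S n + k));
              [symmetry; exact (sum_scal_l _ _ _)|].
            apply sum_n_ext; intros l; vec V. }
    rewrite E.
    eapply Rle_trans; [apply norm_sum_n_m|].
    apply Rle_trans with (sum_n (fun l => b l + e') (S n + k)).
    - assert (Hle : forall m, (m <= S n + k)%nat -> sum_n (fun l => norm (cavg p (1 / 2)
        (fun z => scal (z ^ l * / z ^ S n : C_AbsRing)%C
        (A (Rs (scaled_symbol k tau z) (g l)))))) m <= sum_n (fun l => b l + e') m).
      { induction m as [|m IH]; intros Hm; [rewrite !sum_O | rewrite !sum_Sn].
        - apply Hp; lia.
        - apply Rplus_le_compat; [apply IH; lia | apply Hp; lia]. }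
      apply Hle; lia.
    - apply Req_le.
      transitivity (sum_n b (S n + k) + sum_n (fun _ => e') (S n + k));
        [exact (sum_n_plus b (fun _ => e') (S n + k))|].
      rewrite sum_n_const; unfold e'; f_equal; field; lra. }
  apply Rle_trans with (sum_n b (S n + k)).
  { apply le_epsilon; intros e He; auto. }
  rewrite (sum_zero_tail b (S n)); [|lia|].
  2: { intros i Hi; unfold b; apply Nat.leb_gt in Hi; now rewrite Hi. }
  (* The norm of [f] starts at index 1; the term of index 0 vanishes because [k >= 1]. *)
  assert (E0 : b 0%nat = 0).
  { unfold b; cbn [Nat.leb]; rewrite Hgn by lia; ring. }
  assert (E1 : sum_n b (S n) = sum_n (fun l => b (S l)) n).
  { unfold sum_n; rewrite (sum_Sn_m b 0) by lia; rewrite E0, <- sum_n_m_S.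
    exact (Rplus_0_l _). }
  rewrite E1.
  rewrite (sum_zero_tail (fun l => harmonic_weight n l * norm (f (S l))) n N); auto.
  2: { intros i Hi; unfold harmonic_weight; apply Nat.leb_gt in Hi; rewrite Hi.
       exact (Rmult_0_l _). }
  assert (EK : K * sum_n (fun l => harmonic_weight n l * norm (f (S l))) n
    = sum_n (fun l => K * (harmonic_weight n l * norm (f (S l)))) n)
    by (symmetry; exact (sum_n_mult_l (K := R_Ring) K _ n)).
  rewrite EK; apply sum_n_m_le; intros l.
  unfold b, harmonic_weight; cbn [Nat.leb Nat.sub].
  destruct (Nat.leb_spec l n) as [Hl | Hl]; [|lra].
  assert (HI := Rinv_0_lt_compat _ (INR_S_pos (n - l))).
  (* Below [k] the residual is 0, and the values of [f] there only enlarge the right-hand side. *)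
  destruct (Nat.lt_ge_cases (S l) k) as [Hlk | Hlk].
  - rewrite Hgn, Rmult_0_r by auto; repeat apply Rmult_le_pos; try lra; apply norm_ge_0.
  - rewrite Hgf by lia; unfold Rdiv; lra.
Qed.

(** * Young's inequality with harmonic weights *)

Definition harmonic (n : nat) : R := sum_n (fun m => / INR (S m)) n.

Lemma sum_n_first (a : nat -> R) (n : nat) :
  sum_n a (S n) = a 0%nat + sum_n (fun i => a (S i)) n.
Proof.
  unfold sum_n; rewrite (sum_Sn_m a 0) by lia; rewrite <- sum_n_m_S; reflexivity.
Qed.

Lemma sum_n_nonneg (a : nat -> R) (n : nat) : (forall i, 0 <= a i) -> 0 <= sum_n a n.
Proof.
  intros H; rewrite <- (sum_n_m_const_zero (G := R_AbelianMonoid) 0 n : _ = 0).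
  now apply sum_n_m_le.
Qed.

Lemma harmonic_succ (n : nat) : harmonic (S n) = harmonic n + / INR (S (S n)).
Proof. unfold harmonic; now rewrite sum_Sn. Qed.

Lemma harmonic_nonneg (n : nat) : 0 <= harmonic n.
Proof.
  apply sum_n_nonneg; intros i; apply Rlt_le, Rinv_0_lt_compat, INR_S_pos.
Qed.

(** The weights depend on [n - l] alone, so removing the first entry of row [S n] leaves row [n]. *)
Lemma harmonic_row (n : nat) : forall N, sum_n (harmonic_weight n) N <= harmonic n.
Proof.
  induction n as [|n IH]; intros N.
  - rewrite (sum_zero_tail _ 0 N); [rewrite sum_O | lia |].
    + unfold harmonic; rewrite sum_O; unfold harmonic_weight; simpl; lra.
    + intros i Hi; unfold harmonic_weight; apply Nat.leb_gt in Hi; now rewrite Hi.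
  - rewrite harmonic_succ.
    assert (E0 : harmonic_weight (S n) 0 = / INR (S (S n))) by reflexivity.
    destruct N as [|N].
    + rewrite sum_O, E0; assert (H := harmonic_nonneg n); lra.
    + rewrite sum_n_first, E0; specialize (IH N).
      change (fun i => harmonic_weight (S n) (S i)) with (harmonic_weight n); lra.
Qed.

Lemma harmonic_column (l : nat) : forall N,
  sum_n (fun n => harmonic_weight n l) N <= harmonic N.
Proof.
  induction l as [|l IH]; intros N.
  - apply Req_le; apply sum_n_ext; intros n; unfold harmonic_weight; simpl.
    now rewrite Nat.sub_0_r.
  - destruct N as [|N].
    + rewrite sum_O; unfold harmonic_weight; simpl; apply harmonic_nonneg.
    + rewrite sum_n_first, harmonic_succ; specialize (IH N).
      change (fun i => harmonic_weight (S i) (S l)) with (fun i => harmonic_weight i l).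
      assert (E0 : harmonic_weight 0 (S l) = 0) by reflexivity.
      assert (H := Rinv_0_lt_compat _ (INR_S_pos (S N))); lra.
Qed.

(** [ln y <= y - 1] at [y = x / (x + 1)] gives [1 / (x + 1) <= ln (x + 1) - ln x], which
    telescopes. *)
Lemma harmonic_le_ln (n : nat) : harmonic n <= 1 + ln (INR (S n)).
Proof.
  induction n as [|n IH].
  - unfold harmonic; rewrite sum_O; simpl; rewrite ln_1, Rinv_1; lra.
  - rewrite harmonic_succ.
    assert (Hn := INR_S_pos n); assert (Hn2 := INR_S_pos (S n)).
    rewrite (S_INR (S n)) in *; set (x := INR (S n)) in *.
    assert (Hq : 0 < x / (x + 1)) by now apply Rdiv_lt_0_compat.
    assert (H : ln (x / (x + 1)) <= x / (x + 1) - 1).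
    { assert (T := exp_ineq1_le (ln (x / (x + 1)))); rewrite exp_ln in T; lra. }
    rewrite ln_div in H by auto.
    replace (x / (x + 1) - 1) with (- / (x + 1)) in H by (field; lra); lra.
Qed.

Lemma sum_n_Rmult_l (c : R) (a : nat -> R) (n : nat) :
  sum_n (fun i => c * a i) n = c * sum_n a n.
Proof. exact (sum_n_mult_l (K := R_Ring) c a n). Qed.

Lemma sum_n_Rmult_r (c : R) (a : nat -> R) (n : nat) :
  sum_n (fun i => a i * c) n = sum_n a n * c.
Proof. exact (sum_n_mult_r (K := R_Ring) c a n). Qed.

Lemma sum_n_Rplus (a b : nat -> R) (n : nat) :
  sum_n (fun i => a i + b i) n = sum_n a n + sum_n b n.
Proof. exact (sum_n_plus a b n). Qed.

(** * Nonnegative powers, Jensen's inequality and the Schur test *)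

Lemma pow_nneg_0 (q : R) : pow_nneg 0 q = 0.
Proof. unfold pow_nneg; destruct (Rle_dec 0 0); lra. Qed.

Lemma pow_nneg_pos (x y : R) : 0 < x -> pow_nneg x y = Rpower x y.
Proof. intros H; unfold pow_nneg; destruct (Rle_dec x 0); [lra | reflexivity]. Qed.

Lemma pow_nneg_ge_0 (x y : R) : 0 <= pow_nneg x y.
Proof.
  unfold pow_nneg; destruct (Rle_dec x 0); [lra | apply Rlt_le, exp_pos].
Qed.

Lemma pow_nneg_le (x y z : R) : 0 < z -> x <= y -> pow_nneg x z <= pow_nneg y z.
Proof.
  intros Hz H; destruct (Rle_lt_dec x 0) as [Hx | Hx].
  - unfold pow_nneg at 1; destruct (Rle_dec x 0); [apply pow_nneg_ge_0 | lra].
  - rewrite !pow_nneg_pos by lra; apply Rle_Rpower_l; lra.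
Qed.

Lemma pow_nneg_mult (x y z : R) : 0 <= x -> 0 <= y ->
  pow_nneg (x * y) z = pow_nneg x z * pow_nneg y z.
Proof.
  intros Hx Hy; destruct (Req_dec x 0) as [-> | Hx0].
  { rewrite Rmult_0_l; unfold pow_nneg; destruct (Rle_dec 0 0); lra. }
  destruct (Req_dec y 0) as [-> | Hy0].
  { rewrite Rmult_0_r; unfold pow_nneg; destruct (Rle_dec 0 0); lra. }
  rewrite !pow_nneg_pos by (try apply Rmult_lt_0_compat; lra).
  symmetry; apply Rpower_mult_distr; lra.
Qed.

Lemma pow_nneg_inv (q x : R) : 1 <= q -> 0 <= x -> pow_nneg (pow_nneg x q) (/ q) = x.
Proof.
  intros Hq Hx; destruct (Req_dec x 0) as [-> | Hx0].
  { rewrite pow_nneg_0; unfold pow_nneg; destruct (Rle_dec 0 0); lra. }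
  rewrite (pow_nneg_pos x) by lra; rewrite pow_nneg_pos by apply exp_pos.
  rewrite Rpower_mult, Rinv_r, Rpower_1; lra.
Qed.

Lemma pow_nneg_tangent (q t : R) : 1 <= q -> 0 <= t -> 1 + q * (t - 1) <= pow_nneg t q.
Proof.
  intros Hq Ht; destruct (Req_dec t 0) as [-> | Ht0].
  { rewrite pow_nneg_0; lra. }
  rewrite pow_nneg_pos by lra; unfold Rpower.
  (* weighted AM-GM for [t ^ q] and 1, from the tangent to [exp] at [ln t] *)
  set (L := ln t).
  assert (E : t = exp L) by (unfold L; rewrite exp_ln; lra).
  assert (H1 := exp_ineq1_le (q * L - L)); assert (H2 := exp_ineq1_le (- L)).
  replace (exp (q * L)) with (t * exp (q * L - L))
    by (rewrite E, <- exp_plus; f_equal; ring).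
  assert (H3 : t * exp (- L) = 1) by (rewrite E, <- exp_plus, Rplus_opp_r; apply exp_0).
  assert (Htp : 0 < t) by lra.
  assert (H4 : t * (1 + (q * L - L)) <= t * exp (q * L - L))
    by (apply Rmult_le_compat_l; lra).
  assert (H5 : t * (1 + - L) <= t * exp (- L)) by (apply Rmult_le_compat_l; lra).
  rewrite H3 in H5.
  assert (0 <= (q - 1) * (1 - t * (1 + - L))) by (apply Rmult_le_pos; lra).
  lra.
Qed.

(** Jensen's inequality for [t^q] with weights [w / W], from the tangent at the mean [y]. The total
    weight may fall short of 1: the deficit [W - sum w] enters with the favourable factor
    [q - 1 >= 0]. *)
Lemma jensen_pow (q : R) (w b : nat -> R) (W : R) (N : nat) :
  1 <= q -> 0 < W -> (forall l, 0 <= w l) -> (forall l, 0 <= b l) -> sum_n w N <= W ->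
  W * pow_nneg (sum_n (fun l => w l * b l) N / W) q
    <= sum_n (fun l => w l * pow_nneg (b l) q) N.
Proof.
  intros Hq HW Hw Hb HwW; set (S := sum_n (fun l => w l * b l) N); set (y := S / W).
  assert (HS : 0 <= S).
  { apply sum_n_nonneg; intros l; now apply Rmult_le_pos. }
  destruct (Req_dec S 0) as [HS0 | HS0].
  { replace y with 0 by (unfold y; rewrite HS0; field; lra).
    rewrite pow_nneg_0, Rmult_0_r; apply sum_n_nonneg; intros l.
    apply Rmult_le_pos; auto; apply pow_nneg_ge_0. }
  assert (Hy : 0 < y) by (apply Rdiv_lt_0_compat; lra).
  set (P := pow_nneg y q).
  assert (HP : 0 <= P) by apply pow_nneg_ge_0.
  apply Rle_trans with (sum_n (fun l => P * (1 - q) * w l + P * q / y * (w l * b l)) N).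
  - rewrite sum_n_Rplus, !sum_n_Rmult_l; fold S.
    replace (P * q / y * S) with (P * q * W) by (unfold y; field; lra).
    assert (0 <= P * (q - 1) * (W - sum_n w N))
      by (apply Rmult_le_pos; [apply Rmult_le_pos|]; lra).
    lra.
  - apply sum_n_m_le; intros l.
    assert (Hby : 0 <= b l / y).
    { apply Rmult_le_pos; auto; now apply Rlt_le, Rinv_0_lt_compat. }
    assert (T := pow_nneg_tangent q (b l / y) Hq Hby).
    replace (b l) with (y * (b l / y)) at 2 by (field; lra).
    rewrite pow_nneg_mult by lra; fold P.
    replace (P * (1 - q) * w l + P * q / y * (w l * b l))
      with (w l * (P * (1 + q * (b l / y - 1)))) by (field; lra).
    apply Rmult_le_compat_l; auto; now apply Rmult_le_compat_l.
Qed.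

(** Schur test: Jensen's inequality on each row gives the factor [W^q / W]; after interchanging the
    sums, the columns give another [W], and the [q]-th root of [W^q] is [W]. *)
Lemma young_pow (q : R) (w : nat -> nat -> R) (a b : nat -> R) (W : R) (N : nat) :
  1 <= q -> 0 < W -> (forall n l, 0 <= w n l) -> (forall l, 0 <= b l) -> (forall n, 0 <= a n) ->
  (forall n, (n <= N)%nat -> sum_n (w n) N <= W) ->
  (forall l, sum_n (fun n => w n l) N <= W) ->
  (forall n, (n <= N)%nat -> a n <= sum_n (fun l => w n l * b l) N) ->
  pow_nneg (sum_n (fun n => pow_nneg (a n) q) N) (/ q)
    <= W * pow_nneg (sum_n (fun l => pow_nneg (b l) q) N) (/ q).
Proof.
  intros Hq HW Hw Hb Ha Hrow Hcol Hab.
  set (B := sum_n (fun l => pow_nneg (b l) q) N).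
  assert (HB : 0 <= B) by (apply sum_n_nonneg; intros l; apply pow_nneg_ge_0).
  assert (Hiq : 0 < / q) by (apply Rinv_0_lt_compat; lra).
  assert (HPW := pow_nneg_ge_0 W q).
  rewrite <- (pow_nneg_inv q W) by lra.
  rewrite <- pow_nneg_mult by auto.
  apply pow_nneg_le; auto.
  apply Rle_trans with (sum_n (fun n => pow_nneg W q / W *
    sum_n (fun l => w n l * pow_nneg (b l) q) N) N).
  - assert (Hle : forall m, (m <= N)%nat -> sum_n (fun n => pow_nneg (a n) q) m
      <= sum_n (fun n => pow_nneg W q / W * sum_n (fun l => w n l * pow_nneg (b l) q) N) m).
    { assert (Hterm : forall n, (n <= N)%nat -> pow_nneg (a n) q
        <= pow_nneg W q / W * sum_n (fun l => w n l * pow_nneg (b l) q) N).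
      { intros n Hn.
        assert (HS : 0 <= sum_n (fun l => w n l * b l) N)
          by (apply sum_n_nonneg; intros l; now apply Rmult_le_pos).
        apply Rle_trans with (pow_nneg (W * (sum_n (fun l => w n l * b l) N / W)) q).
        - apply pow_nneg_le; [lra|].
          assert (E : W * (sum_n (fun l => w n l * b l) N / W)
            = sum_n (fun l => w n l * b l) N) by (field; lra).
          rewrite E; auto.
        - rewrite pow_nneg_mult; [|lra|].
          2: { apply Rmult_le_pos; auto; now apply Rlt_le, Rinv_0_lt_compat. }
          assert (J := jensen_pow q (w n) b W N Hq HW (Hw n) Hb (Hrow n Hn)).
          replace (pow_nneg W q * pow_nneg (sum_n (fun l => w n l * b l) N / W) q)
            with (pow_nneg W q / W * (W * pow_nneg (sum_n (fun l => w n l * b l) N / W) q))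
            by (field; lra).
          apply Rmult_le_compat_l; auto.
          apply Rmult_le_pos; auto; now apply Rlt_le, Rinv_0_lt_compat. }
      induction m as [|m IH]; intros Hm; [rewrite !sum_O | rewrite !sum_Sn].
      - apply Hterm; lia.
      - apply Rplus_le_compat; [apply IH; lia | apply Hterm; lia]. }
    apply Hle; lia.
  - rewrite sum_n_Rmult_l, (sum_n_switch (fun n l => w n l * pow_nneg (b l) q)).
    replace (pow_nneg W q * B) with (pow_nneg W q / W * (W * B)) by (field; lra).
    apply Rmult_le_compat_l.
    { apply Rmult_le_pos; auto; now apply Rlt_le, Rinv_0_lt_compat. }
    unfold B; rewrite <- sum_n_Rmult_l; apply sum_n_m_le; intros l.
    rewrite sum_n_Rmult_r; apply Rmult_le_compat_r; [apply pow_nneg_ge_0 | apply Hcol].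
Qed.

Lemma fold_Rmax_ge (l : list nat) (g : nat -> R) (n : nat) :
  In n l -> g n <= fold_right Rmax 0 (map g l).
Proof.
  induction l as [|m l IH]; simpl; [tauto|].
  intros [-> | H]; [apply Rmax_l | apply Rle_trans with (2 := Rmax_r _ _); auto].
Qed.

Lemma fold_Rmax_le (l : list nat) (g : nat -> R) (B : R) :
  0 <= B -> (forall n, In n l -> g n <= B) -> fold_right Rmax 0 (map g l) <= B.
Proof.
  intros HB; induction l as [|m l IH]; simpl; intros H; [auto|].
  apply Rmax_lub; auto.
Qed.

Lemma fold_Rmax_nonneg (l : list R) : 0 <= fold_right Rmax 0 l.
Proof.
  induction l as [|x l IH]; simpl; [lra | apply Rle_trans with (2 := Rmax_r _ _); auto].
Qed.

Lemma young_lp_norm {X : NormedModule C_AbsRing} (p : Rbar) (w : nat -> nat -> R)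
    (a b : nat -> X) (W : R) (N : nat) :
  Rbar_le (Finite 1) p -> 0 < W -> (forall n l, 0 <= w n l) ->
  (forall n, (n <= N)%nat -> sum_n (w n) N <= W) ->
  (forall l, sum_n (fun n => w n l) N <= W) ->
  (forall n, (n <= N)%nat ->
    norm (a (S n)) <= sum_n (fun l => w n l * norm (b (S l))) N) ->
  lp_norm p (S N) a <= W * lp_norm p (S N) b.
Proof.
  intros Hp HW Hw Hrow Hcol Hab; destruct p as [q | |]; simpl in Hp; [| |tauto].
  - unfold lp_norm.
    rewrite <- !sum_n_m_S.
    apply (young_pow q w (fun n => norm (a (S n))) (fun l => norm (b (S l))) W N);
      auto; intros; apply norm_ge_0.
  - unfold lp_norm; set (B := fold_right Rmax 0 (map (fun n => norm (b n)) (seq 1 (S N)))).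
    assert (HB : 0 <= B) by apply fold_Rmax_nonneg.
    apply fold_Rmax_le; [apply Rmult_le_pos; lra|].
    intros n Hn; apply in_seq in Hn; destruct n as [|n]; [lia|].
    assert (Hn' : (n <= N)%nat) by lia.
    apply Rle_trans with (1 := Hab n Hn').
    apply Rle_trans with (sum_n (w n) N * B).
    + rewrite <- sum_n_Rmult_r.
      (* The termwise comparison below is over all indices, whereas [B] dominates only those up to
         [N]; within this range the minimum changes nothing. *)
      rewrite (sum_n_ext_loc _ (fun l => w n l * Rmin (norm (b (S l))) B)).
      * apply sum_n_m_le; intros l; apply Rmult_le_compat_l; auto; apply Rmin_r.
      * intros l Hl; rewrite Rmin_left; auto.
        apply (fold_Rmax_ge _ (fun n => norm (b n))); apply in_seq; lia.
    + apply Rmult_le_compat_r; auto.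
Qed.

(** * Sector condition *)

Lemma Carg_scale (t : R) (z : C) : 0 < t -> Carg (RtoC t * z)%C = Carg z.
Proof.
  intros Ht; unfold Carg.
  assert (ER : Re (RtoC t * z)%C = t * Re z)
    by (unfold Re, Cmult, RtoC; cbn [fst snd]; ring).
  assert (EI : Im (RtoC t * z)%C = t * Im z)
    by (unfold Im, Cmult, RtoC; cbn [fst snd]; ring).
  assert (EM : Cmod (RtoC t * z) = t * Cmod z)
    by (rewrite Cmod_mult, Cmod_R, Rabs_pos_eq; lra).
  assert (EQ : t * Re z / (t * Cmod z) = Re z / Cmod z).
  { unfold Rdiv; rewrite Rinv_mult.
    replace (t * Re z * (/ t * / Cmod z)) with (t * / t * (Re z * / Cmod z)) by ring.
    rewrite Rinv_r; lra. }
  rewrite ER, EI, EM, EQ.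
  destruct (Rle_dec 0 (t * Im z)) as [H1 | H1], (Rle_dec 0 (Im z)) as [H2 | H2]; auto.
  - exfalso; apply H2; apply Rmult_le_reg_l with t; lra.
  - exfalso; apply H1; apply Rmult_le_pos; lra.
Qed.

Lemma Rabs_Carg_le (z : C) : Rabs (Carg z) <= PI.
Proof.
  unfold Carg; assert (H := acos_bound (Re z / Cmod z)).
  destruct (Rle_dec 0 (Im z)); [|rewrite Rabs_Ropp]; rewrite Rabs_pos_eq; lra.
Qed.

Lemma bdf_symbol_neq_0 (k : nat) (z : C) : (1 <= k <= 6)%nat -> Cmod z <= 1 ->
  z <> RtoC 1 -> bdf_symbol k z <> RtoC 0.
Proof.
  intros Hk Hz Hz1; destruct (bdf_zero_stable k Hk) as [c [Hc H]].
  apply Cmod_gt_0; apply Rlt_le_trans with (2 := H z Hz).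
  apply Rmult_lt_0_compat; auto; apply Cmod_gt_0; intros E; apply Hz1.
  replace z with (1 - (1 - z))%C by ring; rewrite E; ring.
Qed.

(** If no such [alpha] existed, [PI - theta] would be an upper bound below the supremum. Since
    [real] sends infinite values to 0, the supremum must also be shown to be finite. *)
Lemma bdf_angle_lt (k : nat) (theta : R) : (1 <= k <= 6)%nat ->
  PI - bdf_angle k < theta ->
  exists alpha, A_alpha_stable k alpha /\ PI - alpha < theta.
Proof.
  intros Hk Ht.
  destruct (Lub_Rbar_correct (A_alpha_stable k)) as [Hub Hlub].
  unfold bdf_angle in Ht; set (l := Lub_Rbar (A_alpha_stable k)) in *.
  (* 0 is admissible by zero-stability, and testing at [zeta = 0] bounds every admissible angle by
     [PI]. *)
  assert (H0 : A_alpha_stable k 0).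
  { intros z Hz Hz1; split; [now apply bdf_symbol_neq_0|].
    rewrite Rminus_0_r; apply Rabs_Carg_le. }
  assert (HPI : is_ub_Rbar (A_alpha_stable k) (Finite PI)).
  { intros alpha Ha; simpl.
    destruct (Ha (RtoC 0)) as [_ H].
    - rewrite Cmod_0; lra.
    - intros E; injection E; lra.
    - assert (H' := Rabs_pos (Carg (bdf_symbol k 0))); lra. }
  apply NNPP; intros Hno.
  assert (Hub2 : is_ub_Rbar (A_alpha_stable k) (Finite (PI - theta))).
  { intros alpha Ha; simpl; apply Rnot_lt_le; intros H; apply Hno.
    exists alpha; split; auto; lra. }
  apply Hlub in Hub2; apply Hlub in HPI; specialize (Hub _ H0).
  destruct l as [l | |]; simpl in *; lra || tauto.
Qed.

(** * The logarithmic bound in [l^p] *)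

Theorem theorem7p2 (X : CompleteNormedModule C_AbsRing) (A : linear_operator X)
    (k : nat) (theta : R)
    (hA : generates_analytic_semigroup A)
    (hk : (1 <= k <= 6)%nat)
    (htheta : PI - bdf_angle k < theta)
    (hres : A_resolvent_bounded A theta) :
  exists K : R,
    forall (p : Rbar) (N : nat) (tau : R) (f u : nat -> X),
      Rbar_le (Finite 1) p -> (2 <= N)%nat -> 0 < tau ->
      bdf_solution A k N tau f u ->
      lp_norm p N (fun n => A (u n)) <= K * ln (INR N) * lp_norm p N f.
Proof.
  destruct (bdf_angle_lt k theta hk htheta) as [alpha [Hstable Halpha]].
  destruct hres as [M0 HM0].
  set (M := Rmax 0 M0).
  assert (HM : 0 <= M) by apply Rmax_l.
  set (spec := fun (l : C) (Res : X -> X) =>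
    is_resolvent A l Res /\ forall x, norm (A (Res x)) <= M * norm x).
  (* The resolvents are given for each [l] separately; [epsilon] turns them into one family. *)
  set (Rs := fun l : C => epsilon (inhabits (fun x : X => x)) (spec l)).
  assert (HRs : forall l, sector theta l -> resolvent_bound A M Rs l).
  { intros l Hl; apply (epsilon_spec (inhabits (fun x : X => x)) (spec l)).
    destruct (HM0 l Hl) as [Res [H1 H2]]; exists Res; split; auto.
    intros x; apply Rle_trans with (1 := H2 x).
    apply Rmult_le_compat_r; [apply norm_ge_0 | apply Rmax_r]. }
  destruct (kernel_coefficient A M Rs k hk HM) as [K0 [HK0 Hker]].
  (* Adding 1 keeps [K], and with it [W], positive even for [K0 = 0], as the division by [W] in
     Jensen's inequality requires. *)
  set (K := K0 + 1).
  assert (Hln2 : 0 < ln 2) by (assert (H := ln_lt_2); lra).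
  (* For [N >= 2] one has [1 <= ln N / ln 2], hence [1 + ln N <= (1 / ln 2 + 1) ln N]. *)
  exists (K * (/ ln 2 + 1)).
  intros p N tau f u Hp HN Htau Hsol.
  assert (HR : forall z, Cmod z < 1 -> resolvent_bound A M Rs (scaled_symbol k tau z)).
  { intros z Hz; apply HRs.
    assert (Hit : 0 < / tau) by now apply Rinv_0_lt_compat.
    assert (Hz1 : z <> RtoC 1) by (intros E; rewrite E, Cmod_1 in Hz; lra).
    destruct (Hstable z (Rlt_le _ _ Hz) Hz1) as [H1 H2].
    (* Division by [tau > 0] keeps the argument, which is at most [PI - alpha < theta] in absolute
       value. *)
    unfold scaled_symbol; split; [|rewrite Carg_scale by auto; lra].
    apply Cmult_neq_0; auto; intros E; injection E; lra. }
  destruct N as [|N]; [lia|].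
  set (W := K * (1 + ln (INR (S N)))).
  assert (HlnN : ln 2 <= ln (INR (S N))).
  { assert (H2 : 2 <= INR (S N)) by (apply (le_INR 2); lia).
    destruct H2 as [H2 | <-]; [apply Rlt_le, ln_increasing; lra | lra]. }
  assert (HW : 0 < W) by (apply Rmult_lt_0_compat; unfold K; lra).
  assert (Hharm : forall n, (n <= N)%nat -> K * harmonic n <= W).
  { intros n Hn; apply Rmult_le_compat_l; [unfold K; lra|].
    apply Rle_trans with (1 := harmonic_le_ln n), Rplus_le_compat_l.
    assert (H2 : INR (S n) <= INR (S N)) by (apply le_INR; lia).
    destruct H2 as [H2 | ->]; [apply Rlt_le, ln_increasing; auto; apply INR_S_pos | lra]. }
  assert (Hyoung : lp_norm p (S N) (fun n => A (u n)) <= W * lp_norm p (S N) f).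
  { apply (young_lp_norm p (fun n l => K * harmonic_weight n l)); auto.
    - intros n l; apply Rmult_le_pos; [unfold K; lra | apply harmonic_weight_nonneg].
    - intros n Hn.
      rewrite sum_n_Rmult_l.
      apply Rle_trans with (2 := Hharm n Hn).
      apply Rmult_le_compat_l; [unfold K; lra | apply harmonic_row].
    - intros l.
      rewrite sum_n_Rmult_l.
      apply Rle_trans with (2 := Hharm N (le_n N)).
      apply Rmult_le_compat_l; [unfold K; lra | apply harmonic_column].
    - intros n Hn.
      assert (H := bdf_pointwise_bound A M K0 tau Rs k N f u (proj1 hk) HK0 Htau HR
        (Hker tau Htau HR) Hsol n Hn).
      apply Rle_trans with (1 := H).
      set (s := sum_n (fun l => harmonic_weight n l * norm (f (S l))) N).
      assert (Hs : 0 <= s).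
      { apply sum_n_nonneg; intros l.
        apply Rmult_le_pos; [apply harmonic_weight_nonneg | apply norm_ge_0]. }
      apply Rle_trans with (K * s); [apply Rmult_le_compat_r; unfold K; lra|].
      apply Req_le.
      unfold s; rewrite <- sum_n_Rmult_l.
      apply sum_n_ext; intros l; symmetry; apply Rmult_assoc. }
  apply Rle_trans with (1 := Hyoung).
  apply Rmult_le_compat_r.
  { destruct p as [q | |];
      [apply pow_nneg_ge_0 | apply (fold_Rmax_nonneg (map _ _)) | apply Rle_refl]. }
  unfold W; rewrite Rmult_assoc; apply Rmult_le_compat_l; [unfold K; lra|].
  rewrite Rmult_plus_distr_r, Rmult_1_l; apply Rplus_le_compat_r.
  apply Rmult_le_reg_l with (ln 2); auto.
  rewrite <- Rmult_assoc, Rinv_r, Rmult_1_l, Rmult_1_r; lra.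
Qed.
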